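(* For each $M \in \mathbb{N}$ let $N_M \in \mathbb{N}$ and $z_M = (x_M, y_M) \in I_{N_M} \times I_M$, and suppose that $$\lim_{M \to \infty} N_M = \infty, \qquad \lim_{M \to \infty} \frac{M}{N_M^2} = \infty, \qquad \liminf_{M \to \infty} \frac{y_M}{M} > 0 .$$ Consider the finite-capacity $(N_M, M, z_M)$ model with lifetime $\lambda$. Then, under $\mathbb{P}^{N_M,M}_{z_M}$, as $M \to \infty$, $$\frac{4\lambda}{N_M^2} \cos^M(\pi/N_M) \ \overset{d}{\longrightarrow}\ \mathcal{E}_1,$$ where $\mathcal{E}_1$ is an exponential random variable with mean $1$.
   Context: Notation: $\mathbb{N}=\{1,2,\dots\}$, $\mathbb{Z}_+=\{0,1,2,\dots\}$. For $N\in\mathbb{N}$ with $N\ge 2$, $I_N = \{0,1,\dots,N\}$ with boundary $\partial I_N=\{0,N\}$ and interior $I_N^\circ = I_N\setminus\partial I_N$; similarly $I_M=\{0,1,\dots,M\}$. Finite-capacity $(N,M,z)$ model ($M\in\mathbb{N}$, $z\in I_N\times I_M$): the Markov chain $\zeta_n=(X_n,\eta_n)$, $n\in\mathbb{Z}_+$, with $\zeta_0=z$ and transitions: (1) from $(x,i)$ with $x\in I_N^\circ$, $i\ge 1$, move to $(x+1,i-1)$ or $(x-1,i-1)$ with probability $1/2$ each; (2) states $(x,0)$ with $x\in I_N^\circ$ are absorbing; (3) from $(x,i)$ with $x\in\partial I_N$, move with probability 1 to $(y,M)$, where $y\in I_N^\circ$ is the unique interior site with $|y-x|=1$. Its law is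 $\mathbb{P}^{N,M}_z$. The lifetime is $\lambda=\min\{n\in\mathbb{Z}_+: X_n\in I_N^\circ,\ \eta_n=0\}$ ($\min\emptyset=+\infty$). *)

(* Defs.v *)
From mathcomp Require Import all_boot all_order all_algebra.
From mathcomp Require Import all_classical all_reals all_analysis.

Set Implicit Arguments.
Unset Strict Implicit.
Unset Printing Implicit Defensive.

Import Order.TTheory GRing.Theory Num.Theory.
Import numFieldNormedType.Exports.

Local Open Scope classical_set_scope.
Local Open Scope ring_scope.

(* The time-homogeneous Markov property is written in product form, so that no
   conditioning event of probability zero has to be excluded. *)
Definition markov_chain (R : realType) (S : finType) (p : S -> S -> R) (s0 : S)
    (d : measure_display) (T : measurableType d) (P : probability T R)
    (X : nat -> T -> S) : Prop :=
  [/\ forall n s, measurable (X n @^-1` [set s]),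
      P (X 0%N @^-1` [set s0]) = 1%E &
      forall n (s : nat -> S),
        P (\bigcap_(k in `I_n.+2) (X k @^-1` [set s k])) =
        (P (\bigcap_(k in `I_n.+1) (X k @^-1` [set s k])) *
         (p (s n) (s n.+1))%:E)%E].

(* [(x, i) : fc_state N M] is an element of {0, ..., N} * {0, ..., M}. *)
Definition fc_state (N M : nat) : Type := ('I_N.+1 * 'I_M.+1)%type.

Definition interior_site (N x : nat) : bool := (0 < x < N)%N.

Definition adjacent_sites (x y : nat) : bool := (y == x.+1) || (x == y.+1).

Definition fc_absorbed (N M : nat) (s : fc_state N M) : bool :=
  interior_site N s.1 && (s.2 == 0%N :> nat).

Definition fc_trans (R : realType) (N M : nat) (s t : fc_state N M) : R :=
  if fc_absorbed s then (t == s)%:R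
  else if interior_site N s.1 then
    if adjacent_sites s.1 t.1 && (s.2 == t.2.+1 :> nat) then 2^-1 else 0
  else [&& interior_site N t.1, adjacent_sites s.1 t.1 & t.2 == M :> nat]%:R.

Definition fc_model (R : realType) (N M : nat) (z : fc_state N M)
    (d : measure_display) (T : measurableType d) (P : probability T R)
    (zeta : nat -> T -> fc_state N M) : Prop :=
  markov_chain (@fc_trans R N M) z P zeta.

(* The infimum of the empty set is +oo in \bar R. *)
Definition lifetime (R : realType) (N M : nat) (T : Type)
    (zeta : nat -> T -> fc_state N M) (w : T) : \bar R :=
  ereal_inf [set n%:R%:E | n in [set n | fc_absorbed (zeta n w)]].

(* Pointwise convergence of the distribution functions at the continuity points
   of the limit. The Y n may take infinite values, whereas mu is a probability
   on R. *)
Definition cvg_in_distribution (R : realType) (d : nat -> measure_display)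
    (T : forall n, measurableType (d n)) (P : forall n, probability (T n) R)
    (Y : forall n, T n -> \bar R) (mu : set R -> \bar R) : Prop :=
  forall t : R, {for t, continuous (fun x : R => mu `]-oo, x]%classic)} ->
    P n [set w | (Y n w <= t%:E)%E] @[n --> \oo] --> mu `]-oo, t]%classic.

(* Main.v *)
Require Import Defs.
From mathcomp Require Import all_boot all_order all_algebra.
From mathcomp Require Import all_classical all_reals all_analysis.
From mathcomp Require Import measurable_realfun zify ring lra.

Set Implicit Arguments.
Unset Strict Implicit.
Unset Printing Implicit Defensive.

Import Order.TTheory GRing.Theory Num.Theory.
Import numFieldNormedType.Exports.

Local Open Scope classical_set_scope.
Local Open Scope ring_scope.

(* Let tau be the exit time from the interior of simple random walk started at
   x, and let s = 1 / cos th with th N < pi. Then E_x[s^tau] is explicit: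
   hit th x = cos (th (x - N/2)) / cos (th N/2). A function of the form
   H(x, i) = hit th x - k s^i P_x(tau > i) satisfies, at interior sites,
   H(x, i + 1) = s (H(x + 1, i) + H(x - 1, i)) / 2; it equals 1 on the boundary
   and is >= 0 (if k = 1) or <= 0 (if k = max hit) at the absorbing states. So
   s^(-n) H is a super- or subsolution of the recursion for P(lambda > n),
   according to the sign of
   s H(1, M) - 1 = tan th tan (th N/2) - k s^(M+1) P_1(tau > M).
   The spectral expansion of the killed walk gives
   P_1(tau > M) ~ (4/N) cos^M (pi/N), so with a = (4/N^2) cos^M (pi/N) the choice
   th^2 = 2 ka a yields a supersolution if ka < 1 and a subsolution if ka > 1,
   and P(lambda > t/a) is squeezed between quantities tending to exp (- ka t);
   then let ka tend to 1 from both sides. *)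

(** * Survival probabilities of finite Markov chains *)

(** For a transition matrix [p], this is the probability that the chain from [s] stays out of [A] at
    all times 0, ..., n, endpoints included. First-step analysis serves as the definition, so
    comparison bounds follow by induction on [n]. *)
Fixpoint avoid (R : realType) (S : finType) (p : S -> S -> R) (A : pred S)
    (n : nat) (s : S) : R :=
  if A s then 0 else
  if n is n'.+1 then \sum_t p s t * avoid p A n' t else 1.

Lemma measurable_avoid (S : finType) (d : measure_display)
    (T : measurableType d) (X : T -> S) (A : pred S) :
  (forall s, measurable (X @^-1` [set s])) -> measurable [set w | ~~ A (X w)].
Proof.
move=> mX; rewrite (_ : [set w | _] = \bigcup_(s in [set s | ~~ A s]) (X @^-1` [set s])).
  by apply: fin_bigcup_measurable => // s _; exact: mX.
apply/seteqP; split=> [w /= Aw|w [s /= As /= ->]//].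
by exists (X w).
Qed.

(** Induction on [m] with the cylinder kept arbitrary: splitting over the value at time [n + 1]
    lengthens the cylinder by one step, and the product form of the Markov property supplies the
    factor [p]. *)
Lemma markov_chain_avoid_cylinder (R : realType) (S : finType)
    (p : S -> S -> R) (s0 : S) (d : measure_display) (T : measurableType d)
    (P : probability T R) (X : nat -> T -> S) (A : pred S) :
  markov_chain p s0 P X -> forall m n (s : nat -> S),
  P (\bigcap_(k in `I_n.+1) (X k @^-1` [set s k]) `&`
     \bigcap_(k in `I_m.+1) [set w | ~~ A (X (n + k)%N w)]) =
  (P (\bigcap_(k in `I_n.+1) (X k @^-1` [set s k])) *
   (avoid p A m (s n))%:E)%E.
Proof.
move=> [mX _ PX].
have mcyl n s : measurable (\bigcap_(k in `I_n.+1) (X k @^-1` [set s k])).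
  by apply: bigcap_measurableType => // k _; exact: mX.
have mA n := measurable_avoid A (mX n).
have mAs n m : measurable (\bigcap_(k in `I_m.+1) [set w | ~~ A (X (n + k)%N w)]).
  by apply: bigcap_measurableType => // k _; exact: mA.
elim=> [|m IH] n s.
  rewrite /=; case: ifPn => As; [rewrite mule0|rewrite mule1].
    rewrite (_ : _ `&` _ = set0) ?measure0//; apply/seteqP; split => // w [/= sw Aw].
    by have := Aw 0%N isT; rewrite /= addn0 (sw n)//= As.
  congr (P _); apply/seteqP; split => [w []//|w sw]; split => //.
  by case=> // _; rewrite /= addn0 (sw n)/=.
rewrite /=; case: ifPn => As.
  rewrite mule0 (_ : _ `&` _ = set0) ?measure0//; apply/seteqP; split => // w [/= sw Aw].
  by have := Aw 0%N isT; rewrite /= addn0 (sw n)//= As.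
(* [F t] is the part of the event on which the chain sits at [t] at time [n + 1]; these parts are
   disjoint and cover the event. *)
pose s' t k := if k == n.+1 then t else s k.
pose F t := \bigcap_(k in `I_n.+2) (X k @^-1` [set s' t k]) `&`
     \bigcap_(k in `I_m.+1) [set w | ~~ A (X (n.+1 + k)%N w)].
have s'S t : s' t n.+1 = t by rewrite /s' eqxx.
have s'k t k : (k < n.+1)%N -> s' t k = s k.
  by move=> kn; rewrite /s'; case: eqP => // kE; rewrite kE ltnn in kn.
transitivity (P (\bigcup_(t in [set: S]) F t)).
  congr (P _); apply/seteqP; split => [w [/= sw Aw]|w [t _ [/= sw Aw]]].
    exists (X n.+1 w) => //; split => k /= kn.
      move: (kn); rewrite ltnS leq_eqVlt => /predU1P[->|kn']; first by rewrite s'S.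
      by rewrite s'k//; apply: sw.
    by rewrite addSnnS; apply: (Aw k.+1).
  split => k /= kn; first by rewrite (sw k (ltnW kn)) s'k.
  case: k kn => [_|k kn]; first by rewrite addn0 (sw n)//= s'k.
  by rewrite -addSnnS; exact: Aw.
rewrite measure_fin_bigcup//.
- rewrite (_ : [set: S] = [set` enum S]); last first.
    by apply/seteqP; split => t /= _ //; rewrite mem_enum.
  rewrite -fsbig_seq ?enum_uniq// big_enum/=.
  set C := \bigcap_(k in _) _; have CE : P C = (fine (P C))%:E.
    by rewrite fineK// fin_num_measure//; exact: mcyl.
  rewrite CE -EFinM mulr_sumr -sumEFin; apply: eq_bigr => t _.
  rewrite /F (IH n.+1 (s' t)) s'S PX s'S s'k// mulrA !EFinM -CE.
  by rewrite /C (eq_bigcapr (G := fun k => X k @^-1` [set s k]))// => k /= kn; rewrite s'k.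
- exact: finite_finset.
- move=> t1 t2 _ _ [w [[/= w1 _] [/= w2 _]]].
  have /= := w1 n.+1 (ltnSn _); have /= -> := w2 n.+1 (ltnSn _).
  by rewrite !s'S => ->.
- by move=> t _; apply: measurableI.
Qed.

Lemma markov_chain_avoid (R : realType) (S : finType)
    (p : S -> S -> R) (s0 : S) (d : measure_display) (T : measurableType d)
    (P : probability T R) (X : nat -> T -> S) (A : pred S) (m : nat) :
  markov_chain p s0 P X ->
  measurable (\bigcap_(k in `I_m.+1) [set w | ~~ A (X k w)]) /\
  P (\bigcap_(k in `I_m.+1) [set w | ~~ A (X k w)]) = (avoid p A m s0)%:E.
Proof.
move=> mcX; have [mX PX0 _] := mcX.
have mA n := measurable_avoid A (mX n).
set B := \bigcap_(k in _) _.
have mB : measurable B by apply: bigcap_measurableType => // k _; exact: mA.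
split => //.
have := markov_chain_avoid_cylinder A mcX m 0 (fun=> s0).
rewrite (_ : \bigcap_(k in `I_1) _ = X 0%N @^-1` [set s0]); last first.
  apply/seteqP; split => [w /(_ 0%N isT)//|w Xw [|k]//].
rewrite PX0 mul1e => <-; rewrite -/B.
have mC : measurable (X 0%N @^-1` [set s0]) by exact: mX.
(* The chain starts at [s0] almost surely, so intersecting with that event does not change the
   probability. *)
rewrite -[in LHS](setIT B) -(setUv (X 0%N @^-1` [set s0])) setIUr measureU//.
- rewrite [X in (_ + X)%E](_ : _ = 0%E) ?adde0; first by rewrite setIC.
  apply/eqP; rewrite eq_le measure_ge0 andbT.
  apply: (@le_trans _ _ (P (~` (X 0%N @^-1` [set s0])))).
    by apply: le_measure; rewrite ?inE//; [apply: measurableI => //|]; exact: measurableC.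
  by rewrite probability_setC// PX0 subee.
- exact: measurableI.
- by apply: measurableI => //; exact: measurableC.
- by apply/seteqP; split => // w [[_ ?] [_ ?]].
Qed.

(** The lifetime is a natural number or infinite, so it is at most [t / a] exactly when absorption
    occurs by time floor(t / a). *)
Lemma lifetime_leE (R : realType) (N M : nat) (T : Type)
    (zeta : nat -> T -> fc_state N M) (a t : R) : 0 < a -> 0 <= t ->
  [set w | (a%:E * lifetime R zeta w <= t%:E)%E] =
  ~` \bigcap_(k in `I_(Num.truncn (t / a)).+1)
       [set w | ~~ fc_absorbed (zeta k w)].
Proof.
move=> a0 t0; set m := Num.truncn _.
have ta0 : 0 <= t / a by rewrite divr_ge0// ltW.
have /andP[mt tm] := truncn_itv ta0; rewrite -/m in mt tm.
have E x : (a%:E * x <= t%:E)%E = (x <= (t / a)%:E)%E.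
  by rewrite -lee_pdivlMl// -EFinM mulrC.
apply/seteqP; split => w /=.
  rewrite E => lew nabs.
  have : (m.+1%:R%:E <= lifetime R zeta w)%E.
    apply: le_ereal_inf_tmp => _ [n /= an <-]; rewrite lee_fin ler_nat ltnNge.
    by apply/negP => nm; have := nabs n nm; rewrite /= an.
  by move=> /le_trans/(_ lew); rewrite lee_fin leNgt tm.
move=> nabs; rewrite E.
have [k [km ak]] : exists k, (k <= m)%N /\ fc_absorbed (zeta k w).
  apply: contrapT => nk; apply: nabs => k /= km; apply/negP => ak.
  by apply: nk; exists k.
apply: (@le_trans _ _ (k%:R%:E)%E); first by apply: ereal_inf_lbound; exists k.
by rewrite lee_fin (le_trans _ mt)// ler_nat.
Qed.

Lemma lifetime_lt0E (R : realType) (N M : nat) (T : Type)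
    (zeta : nat -> T -> fc_state N M) (a t : R) : 0 < a -> t < 0 ->
  [set w | (a%:E * lifetime R zeta w <= t%:E)%E] = set0.
Proof.
move=> a0 t0; apply/seteqP; split => // w /= /le_lt_trans/(_ (_ : (t%:E < 0)%E)).
rewrite lte_fin => /(_ t0); rewrite ltNge => /negP; apply.
apply: mule_ge0; first by rewrite lee_fin ltW.
by apply: le_ereal_inf_tmp => _ [n _ <-]; rewrite lee_fin.
Qed.

(** * Comparison principles for the (N, M) chain *)

Lemma fc_trans_ge0 (R : realType) (N M : nat) (s t : fc_state N M) :
  0 <= fc_trans R s t.
Proof.
rewrite /fc_trans; case: ifP => // _; case: ifP => // _.
by case: ifP => // _; rewrite invr_ge0.
Qed.

Lemma sum_fc_trans_interior (R : realType) (N M : nat) (F : nat -> nat -> R)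
    (s : fc_state N M) (i : nat) : interior_site N s.1 -> s.2 = i.+1 :> nat ->
  \sum_t fc_trans R s t * F t.1 t.2 = (F s.1.+1 i + F s.1.-1 i) / 2.
Proof.
case: s => x y /= /[dup] Ix /andP[x0 xN] yi.
have iM : (i < M.+1)%N by rewrite ltnW// -yi.
have x1 : (x.+1 < N.+1)%N by [].
have x2 : (x.-1 < N.+1)%N by rewrite ltnS (leq_trans (leq_pred _))// ltnW.
pose t1 : fc_state N M := (Ordinal x1, Ordinal iM).
pose t2 : fc_state N M := (Ordinal x2, Ordinal iM).
have t12 : t2 != t1.
  by apply/eqP => -[/eqP]; rewrite ltn_eqF// (leq_ltn_trans (leq_pred _)).
rewrite (bigD1 t1)//= (bigD1 t2)//= big1 ?addr0 => [|[x' y'] /andP[tt1 tt2]]; last first.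
  rewrite /fc_trans /fc_absorbed /= Ix yi /= eqSS.
  case: ifP => [/andP[axx /eqP yy]|]; last by rewrite mul0r.
  case/orP: axx => /eqP xx.
    by case/eqP: tt1; congr pair; apply: val_inj => /=.
  by case/eqP: tt2; congr pair; apply: val_inj => //=; rewrite xx.
rewrite /fc_trans /fc_absorbed /adjacent_sites /= Ix yi /= !eqxx /= prednK// eqxx orbT.
by rewrite mulrDl ![2^-1 * _]mulrC.
Qed.

Lemma sum_fc_trans_boundary (R : realType) (N M : nat) (F : nat -> nat -> R)
    (s : fc_state N M) : (1 < N)%N -> ~~ interior_site N s.1 ->
  \sum_t fc_trans R s t * F t.1 t.2 = F (if s.1 == 0%N :> nat then 1%N else N.-1) M.
Proof.
case: s => x y /= N1 Ix.
have yN : ((if x == 0%N :> nat then 1%N else N.-1) < N.+1)%N.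
  by case: ifP => // _; [rewrite ltnW|rewrite ltnS leq_pred].
pose t1 : fc_state N M := (Ordinal yN, ord_max).
have xE : x = 0%N :> nat \/ x = N :> nat.
  move: Ix; rewrite /interior_site negb_and -!leqNgt leqn0.
  case/orP => [/eqP ->|Nx]; [by left|right; apply/eqP].
  by rewrite eqn_leq Nx -ltnS ltn_ord.
rewrite (bigD1 t1)//= big1 ?addr0 => [|[x' y'] tt1]; last first.
  rewrite /fc_trans /fc_absorbed /= (negPf Ix) /=.
  case: (boolP [&& _, _ & _]) => [/and3P[Ix' axx /eqP yM]|_]; last by rewrite mul0r.
  case/eqP: tt1; congr pair; apply: val_inj => //=.
  move: axx Ix'; rewrite /adjacent_sites /interior_site.
  case: xE => -> /=; first by rewrite orbF => /eqP ->.
  case/orP => /eqP xx /andP[x'0]; first by rewrite xx ltnNge leqnSn.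
  by case: eqP => [N0|_ _]; [move: (ltnW N1); rewrite lt0n => /eqP|rewrite [in RHS]xx].
rewrite /fc_trans /fc_absorbed /= (negPf Ix) /= eqxx andbT.
suff -> : interior_site N (if x == 0%N :> nat then 1%N else N.-1) &&
    adjacent_sites x (if x == 0%N :> nat then 1%N else N.-1).
  by rewrite mul1r.
apply/andP; rewrite /interior_site /adjacent_sites; case: xE => -> //=.
have N0 : (0 < N)%N by exact: ltnW.
rewrite (gtn_eqF N0) prednK// eqxx orbT; split => //; rewrite leqnn andbT.
by rewrite -ltnS prednK.
Qed.

Lemma fc_not_absorbed (N M : nat) (s : fc_state N M) : ~~ fc_absorbed s ->
  ~~ interior_site N s.1 \/ interior_site N s.1 /\ exists i, s.2 = i.+1 :> nat.
Proof.
rewrite /fc_absorbed negb_and => /orP[|]; first by left.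
case: (boolP (interior_site N s.1)) => [Ix|]; last by left.
by rewrite -lt0n => s0; right; split => //; exists (s.2 : nat).-1; rewrite prednK.
Qed.

(** Supersolution principle, by induction on [n] and first-step analysis. The offset [n0] lets the
    comparison begin at a positive time, where a better initial bound than 1 is available. *)
Lemma avoid_fc_le (R : realType) (N M n0 : nat) (G : nat -> nat -> nat -> R) :
  (1 < N)%N ->
  (forall s : fc_state N M,
     avoid (@fc_trans R N M) (@fc_absorbed N M) n0 s <= G 0%N s.1 s.2) ->
  (forall n x, interior_site N x -> 0 <= G n x 0%N) ->
  (forall n x i, interior_site N x -> (i < M)%N ->
     (G n x.+1 i + G n x.-1 i) / 2 <= G n.+1 x i.+1) ->
  (forall n i, G n 1%N M <= G n.+1 0%N i) ->
  (forall n i, G n N.-1 M <= G n.+1 N i) ->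
  forall n (s : fc_state N M),
    avoid (@fc_trans R N M) (@fc_absorbed N M) (n + n0) s <= G n s.1 s.2.
Proof.
move=> N1 G0 Ga Gi Gl Gr; elim=> [//|n IH] s /=; case: ifPn => [|ns].
  by move=> /andP[Ix /eqP ->]; exact: Ga.
apply: (@le_trans _ _ (\sum_t fc_trans R s t * G n t.1 t.2)).
  by apply: ler_sum => t _; rewrite ler_wpM2l// fc_trans_ge0.
case/fc_not_absorbed: ns => [Ix|[Ix [i si]]].
  rewrite sum_fc_trans_boundary//; case: eqP => [->//|s0].
  have -> : (s.1 : nat) = N; last exact: Gr.
  apply/eqP; rewrite eqn_leq -ltnS ltn_ord /=.
  move: Ix; rewrite /interior_site negb_and -!leqNgt leqn0.
  by case/orP => // /eqP.
by rewrite (sum_fc_trans_interior _ Ix si) si Gi// -ltnS -si ltn_ord.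
Qed.

Lemma avoid_fc_ge (R : realType) (N M : nat) (G : nat -> nat -> nat -> R) :
  (1 < N)%N ->
  (forall x i, (x <= N)%N -> G 0%N x i <= 1) ->
  (forall n x, interior_site N x -> G n x 0%N <= 0) ->
  (forall n x i, interior_site N x -> (i < M)%N ->
     G n.+1 x i.+1 <= (G n x.+1 i + G n x.-1 i) / 2) ->
  (forall n i, G n.+1 0%N i <= G n 1%N M) ->
  (forall n i, G n.+1 N i <= G n N.-1 M) ->
  forall n (s : fc_state N M),
    G n s.1 s.2 <= avoid (@fc_trans R N M) (@fc_absorbed N M) n s.
Proof.
move=> N1 G0 Ga Gi Gl Gr; elim=> [|n IH] s /=; case: ifPn => [|].
- by move=> /andP[Ix /eqP ->]; exact: Ga.
- by move=> _; apply: G0; rewrite -ltnS.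
- by move=> /andP[Ix /eqP ->]; exact: Ga.
move=> ns; apply: (@le_trans _ _ (\sum_t fc_trans R s t * G n t.1 t.2)); last first.
  by apply: ler_sum => t _; rewrite ler_wpM2l// fc_trans_ge0.
case/fc_not_absorbed: ns => [Ix|[Ix [i si]]].
  rewrite sum_fc_trans_boundary//; case: eqP => [->//|s0].
  have -> : (s.1 : nat) = N; last exact: Gr.
  apply/eqP; rewrite eqn_leq -ltnS ltn_ord /=.
  move: Ix; rewrite /interior_site negb_and -!leqNgt leqn0.
  by case/orP => // /eqP.
by rewrite (sum_fc_trans_interior _ Ix si) si Gi// -ltnS -si ltn_ord.
Qed.

(** * The killed simple random walk *)

(* P_x(tau > i), where tau is the exit time of simple random walk from the
   interior sites. *)
Fixpoint surv (R : realType) (N i x : nat) : R :=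
  if interior_site N x then
    if i is i'.+1 then (surv R N i' x.+1 + surv R N i' x.-1) / 2 else 1
  else 0.

Section Surv.
Variables (R : realType) (N : nat).
Implicit Types (i x : nat).
Local Notation u := (surv R N).

Lemma survS i x : interior_site N x ->
  u i.+1 x = (u i x.+1 + u i x.-1) / 2.
Proof. by move=> /= ->. Qed.

Lemma surv_boundary i x : ~~ interior_site N x -> u i x = 0.
Proof. by case: i => [|i] /= /negPf ->. Qed.

Lemma surv0 i : u i 0%N = 0. Proof. by rewrite surv_boundary. Qed.

Lemma survN i : u i N = 0.
Proof. by rewrite surv_boundary// /interior_site ltnn andbF. Qed.

Lemma surv_ge0 i x : 0 <= u i x.
Proof.
elim: i x => [|i IH] x /=; case: ifP => // _.
by rewrite divr_ge0// addr_ge0.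
Qed.

Lemma surv_le1 i x : u i x <= 1.
Proof.
elim: i x => [|i IH] x /=; case: ifP => // _.
by have := IH x.+1; have := IH x.-1; lra.
Qed.

Lemma surv_nonincr i j x : (i <= j)%N -> u j x <= u i x.
Proof.
move=> ij; rewrite -(subnK ij); elim: (j - i)%N => [//|k IH].
apply: le_trans IH; rewrite addSn.
elim: (k + i)%N x => [|n IH] x.
  by case: (boolP (interior_site N x)) => Ix;
    [rewrite [leRHS]/= Ix surv_le1|rewrite !surv_boundary].
case: (boolP (interior_site N x)) => Ix; last by rewrite !surv_boundary.
by rewrite survS// [leRHS]survS// ler_pM2r// lerD.
Qed.

Lemma interior_site_sub x : (x <= N)%N -> interior_site N (N - x) = interior_site N x.
Proof.
rewrite /interior_site => xN; rewrite subn_gt0 andbC ltn_subrL.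
by case: x xN => //= x /ltn_predK <-.
Qed.

Lemma surv_sym i x : (x <= N)%N -> u i (N - x) = u i x.
Proof.
elim: i x => [|i IH] x xN /=; rewrite interior_site_sub//.
case: ifP => // /andP[x0 xN']; congr (_ / 2).
have -> : (N - x).+1 = (N - x.-1)%N by lia.
have -> : (N - x).-1 = (N - x.+1)%N by lia.
by rewrite !IH 1?addrC//; lia.
Qed.

(** * Generating function of the exit time *)

Variable th : R.
Hypotheses (N1 : (1 < N)%N) (th0 : 0 <= th) (thN : th * N%:R < pi).

Local Notation be := (th * N%:R / 2).

Lemma angle_lt_pihalf : th < pi / 2.
Proof.
rewrite ltr_pdivlMr//; apply: le_lt_trans thN.
by rewrite ler_wpM2l// ler_nat.
Qed.

Lemma cos_gt0_angle : 0 < cos th.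
Proof.
rewrite cos_gt0_pihalf// angle_lt_pihalf andbT.
by rewrite (lt_le_trans _ th0)// oppr_lt0 divr_gt0// pi_gt0.
Qed.

Lemma half_angle_lt_pihalf : be < pi / 2.
Proof. by rewrite ltr_pM2r. Qed.

Lemma cos_gt0_half_angle : 0 < cos be.
Proof.
rewrite cos_gt0_pihalf// half_angle_lt_pihalf andbT.
by rewrite (lt_le_trans (y := 0))// ?oppr_lt0 ?divr_gt0 ?pi_gt0// !mulr_ge0.
Qed.

(* E_x[(1 / cos th)^tau] *)
Definition hit (x : nat) : R := cos (th * x%:R - be) / cos be.

Lemma hit0 : hit 0 = 1.
Proof. by rewrite /hit mulr0 sub0r cosN divff// gt_eqF// cos_gt0_half_angle. Qed.

Lemma hitN : hit N = 1.
Proof.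
rewrite /hit (_ : _ - _ = be); last by field.
by rewrite divff// gt_eqF// cos_gt0_half_angle.
Qed.

Lemma hit_le x : hit x <= (cos be)^-1.
Proof.
by rewrite /hit ler_piMl ?cos_le1// invr_ge0 ltW// cos_gt0_half_angle.
Qed.

(** The angle [th * x - be] has absolute value at most [be], and cosine decreases on [0, pi]. *)
Lemma hit_ge1 x : (x <= N)%N -> 1 <= hit x.
Proof.
move=> xN; rewrite /hit ler_pdivlMr ?cos_gt0_half_angle// mul1r.
have be0 : 0 <= be by rewrite !mulr_ge0.
have xN' : (x%:R : R) <= N%:R by rewrite ler_nat.
have x0 : 0 <= (x%:R : R) by [].
rewrite -[leRHS]cos_norm; set y := `|_|.
have ybe : y <= be.
  rewrite /y ler_norml; apply/andP; split.
    by rewrite lerBrDl addrC addNr mulr_ge0.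
  have := ler_wpM2l th0 xN'; lra.
have bepi : be <= pi by have := half_angle_lt_pihalf; have := @pi_gt0 R; lra.
rewrite leNgt ltr_cos ?in_itv/= ?be0 ?bepi ?normr_ge0 ?(le_trans ybe)//.
by rewrite -leNgt.
Qed.

Lemma hit_rec x : (0 < x)%N -> hit x.+1 + hit x.-1 = 2 * cos th * hit x.
Proof.
case: x => // x _ /=; rewrite /hit -mulrDl mulrA; congr (_ / _).
rewrite (_ : th * x.+2%:R - be = (th * x.+1%:R - be) + th); last first.
  by rewrite -(natr1 x.+1); ring.
rewrite (_ : th * x%:R - be = (th * x.+1%:R - be) - th); last first.
  by rewrite -(natr1 x); ring.
by move: (_ - be) => y; rewrite cosD cosB; ring.
Qed.

(** Super- and subsolutions are decided at the boundary by comparing the value at (1, M) with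
    [cos th]; this form isolates the excess [tan th * tan be]. *)
Lemma hit1 : hit 1 = cos th * (1 + tan th * tan be).
Proof.
have c0 := gt_eqF cos_gt0_angle; have b0 := gt_eqF cos_gt0_half_angle.
rewrite /hit /tan mulr1 cosB; field.
by rewrite b0 c0.
Qed.

Lemma hitN1 : hit N.-1 = hit 1.
Proof.
rewrite /hit mulr1 -[in RHS]cosN; congr (cos _ / _).
by rewrite -subn1 natrB ?(ltnW N1)//; field.
Qed.

Lemma cosVX_ge1 i : 1 <= (cos th)^-1 ^+ i.
Proof. by rewrite exprn_ege1// invf_ge1 ?cos_gt0_angle// cos_le1. Qed.

(** With s = 1 / cos th >= 1, the variable s^tau is at least 1 on tau <= i and at least s^i on tau >
    i; taking expectations gives the bound. The proof is the corresponding induction on [i]. *)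
Lemma surv_hit i x : (x <= N)%N ->
  1 - u i x <= hit x - (cos th)^-1 ^+ i * u i x.
Proof.
have c0 := cos_gt0_angle.
elim: i x => [|i IH] x xN.
  by rewrite expr0 mul1r lerB// hit_ge1.
case: (boolP (interior_site N x)) => [|Ix]; last first.
  by rewrite surv_boundary// mulr0 !subr0 hit_ge1.
move=> /[dup] Ix /andP[x0 xN']; rewrite survS//.
have hE : hit x = (cos th)^-1 * (hit x.+1 + hit x.-1) / 2.
  by rewrite hit_rec//; field; rewrite gt_eqF.
have h1 := IH x.+1 xN'; have h2 := IH x.-1 (leq_trans (leq_pred _) xN).
have s1 : 1 <= (cos th)^-1 by have := cosVX_ge1 1; rewrite expr1.
have u1 := surv_le1 i x.+1; have u2 := surv_le1 i x.-1.
rewrite hE exprS.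
set S := _ ^+ i in h1 h2 *; set c := _^-1 in s1 *.
(* The gap at [i + 1] is half the sum of [c] times the two inductive gaps ([k2]) and the gain from
   the extra factor [c] ([k1]). *)
have k1 : 0 <= (c - 1) * (2 - u i x.+1 - u i x.-1).
  by rewrite mulr_ge0//; lra.
have k2 : 0 <= c * ((hit x.+1 - S * u i x.+1 - (1 - u i x.+1)) +
                    (hit x.-1 - S * u i x.-1 - (1 - u i x.-1))).
  by rewrite mulr_ge0//; lra.
have -> : c * (hit x.+1 + hit x.-1) / 2 - c * S * ((u i x.+1 + u i x.-1) / 2) =
  (c * ((hit x.+1 - S * u i x.+1 - (1 - u i x.+1)) +
        (hit x.-1 - S * u i x.-1 - (1 - u i x.-1)))
  + (c - 1) * (2 - u i x.+1 - u i x.-1)) / 2 + (1 - (u i x.+1 + u i x.-1) / 2).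
  by field.
lra.
Qed.

(** Markov's inequality for s^tau, with [hit] bounded by its maximum [1 / cos be]. *)
Lemma surv_le_cosX i x : (x <= N)%N -> u i x <= cos th ^+ i / cos be.
Proof.
move=> xN; have c0 := cos_gt0_angle.
have := surv_hit i xN; have := surv_le1 i x; have := hit_le x => h1 h2 h3.
have : (cos th)^-1 ^+ i * u i x <= (cos be)^-1 by lra.
by rewrite exprVn ler_pdivrMl ?exprn_gt0.
Qed.

(** * Super- and subsolutions for the survival probability *)

Section Chain.
Variable M : nat.
Local Notation S := (avoid (@fc_trans R N M) (@fc_absorbed N M)).

Let H (k : R) x i := hit x - k * (cos th)^-1 ^+ i * u i x.

Let H_rec k x i : interior_site N x ->
  H k x i.+1 = (cos th)^-1 * ((H k x.+1 i + H k x.-1 i) / 2).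
Proof.
have c0 := cos_gt0_angle.
move=> /[dup] Ix /andP[x0 xN']; rewrite /H survS// exprS.
have -> : hit x = (cos th)^-1 * (hit x.+1 + hit x.-1) / 2.
  by rewrite hit_rec//; field; rewrite gt_eqF.
by ring.
Qed.

Let H_boundary k i : (H k 0%N i = 1) * (H k N i = 1).
Proof. by rewrite /H hit0 hitN surv0 survN mulr0 subr0. Qed.

(** Reflection of the interval identifies the two return values. Whether the bracket lies below or
    above 1 decides between super- and subsolution. *)
Let H_return k : H k N.-1 M = H k 1%N M /\
  H k 1%N M = cos th * (1 + tan th * tan be - k * (cos th)^-1 ^+ M.+1 * u M 1%N).
Proof.
split; first by rewrite /H hitN1 -subn1 surv_sym// ltnW.
by rewrite /H hit1 exprS; field; rewrite gt_eqF ?cos_gt0_angle.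
Qed.

(** Here [k = 1], and the hypothesis gives [H 1 1 M <= cos th], since powers of [1 / cos th] are at
    least 1. At time 0 the function [H] dominates only [1 - u], not 1, so the comparison starts at
    time [M], by which survival has probability at most [1 - u]. *)
Lemma avoid_le_cosX n (s : fc_state N M) : tan th * tan be <= u M 1%N ->
  S (n + M) s <= cos th ^+ n / cos be.
Proof.
move=> tu; have c0 := cos_gt0_angle; have b0 := cos_gt0_half_angle.
have H1 : H 1 1%N M <= cos th.
  have [_ ->] := H_return 1; rewrite ger_pMr// mul1r.
  have := ler_wpM2r (surv_ge0 M 1) (cosVX_ge1 M.+1); lra.
have H0 x i : (x <= N)%N -> 1 - u i x <= H 1 x i.
  by move=> xN; rewrite /H mul1r; exact: surv_hit.
(* Starting with counter at most M, survival for M steps forces the walk to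
   exit before its counter runs out. *)
have SM (t : fc_state N M) : S M t <= 1 - u t.2 t.1.
  (* If [i <= n], surviving to time [n] requires an exit within [i] steps; if [i > n], the counter
     cannot have run out yet and the trivial bound is used. *)
  pose G n x i := if (i <= n)%N then 1 - u i x else 1.
  have Gle1 n' x i : G n' x i <= 1.
    by rewrite /G; case: ifP => // _; rewrite gerBl surv_ge0.
  have -> : 1 - u t.2 t.1 = G M t.1 t.2 by rewrite /G -ltnS ltn_ord.
  rewrite -[X in S X]addn0; apply: avoid_fc_le => //.
  - move=> t' /=; case: ifPn => [/andP[Ix /eqP ->]|]; first by rewrite /G /= Ix subrr.
    case/fc_not_absorbed => [Ix|[Ix [i ->]]]; last by [].
    by rewrite /G surv_boundary// subr0; case: ifP.
  - by move=> n' x Ix; rewrite /G leq0n subr_ge0 surv_le1.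
  - move=> n' x i Ix iM; rewrite /G ltnS; case: ifP => _; last by lra.
    by rewrite survS//; lra.
  - by move=> n' i; apply: (le_trans (Gle1 _ _ _)); rewrite /G surv0 subr0; case: ifP.
  - by move=> n' i; apply: (le_trans (Gle1 _ _ _)); rewrite /G survN subr0; case: ifP.
apply: (@le_trans _ _ (cos th ^+ n * H 1 s.1 s.2)); last first.
  rewrite ler_wpM2l ?exprn_ge0 ?(ltW c0)// (le_trans _ (hit_le s.1))// /H mul1r.
  by rewrite gerBl mulr_ge0 ?surv_ge0// exprn_ge0// invr_ge0 ltW.
pose G n x i := cos th ^+ n * H 1 x i.
apply: (@avoid_fc_le _ _ _ _ G) => //.
- move=> t; rewrite /G expr0 mul1r; apply: (le_trans (SM t)).
  by apply: H0; rewrite -ltnS.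
- move=> n' x /andP[_ xN]; rewrite mulr_ge0 ?exprn_ge0 ?(ltW c0)//.
  by apply: le_trans (H0 _ _ (ltnW xN)); rewrite subr_ge0 surv_le1.
- move=> n' x i Ix iM; rewrite /G H_rec// exprSr mulrA -mulrDr -[_ * cos th * _]mulrA.
  by rewrite divff ?gt_eqF// mulr1 mulrA.
- move=> n' i; rewrite /G H_boundary mulr1 exprSr ler_wpM2l//.
  by rewrite exprn_ge0// ltW.
- move=> n' i; rewrite /G H_boundary mulr1 exprSr ler_wpM2l//.
    by rewrite exprn_ge0// ltW.
  by have [-> _] := H_return 1.
Qed.

(** Taking [k = 1 / cos be], the maximum of [hit], makes [H] nonpositive at absorbing states. The
    prefactor [cos be] brings the value at time 0 below 1, and the hypothesis gives
    [H k 1 M >= cos th]. *)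
Lemma avoid_ge_cosX n (s : fc_state N M) :
  (cos be)^-1 * (cos th)^-1 ^+ M.+1 * u M 1%N <= tan th * tan be ->
  cos be * cos th ^+ n * (1 - (cos be)^-1 * (cos th)^-1 ^+ M * u s.2 s.1)
    <= S n s.
Proof.
move=> tu; have c0 := cos_gt0_angle; have b0 := cos_gt0_half_angle.
set k := (cos be)^-1 in tu *.
have k0 : 0 < k by rewrite invr_gt0.
have H1 : cos th <= H k 1%N M.
  have [_ ->] := H_return k; rewrite ler_pMr//; lra.
have cn0 n' : 0 <= cos be * cos th ^+ n' by rewrite mulr_ge0 ?exprn_ge0 ?(ltW c0) ?(ltW b0).
(* The stated bound is weaker than the subsolution, because [hit] is at least 1 and the counter is
   at most [M]. *)
apply: (@le_trans _ _ (cos be * cos th ^+ n * H k s.1 s.2)).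
  rewrite ler_wpM2l// lerB// ?hit_ge1//; first by rewrite -ltnS.
  rewrite ler_wpM2r ?surv_ge0// ler_wpM2l ?(ltW k0)//.
  have := cosVX_ge1 1; rewrite expr1 => s1.
  by apply: ler_weXn2l => //; rewrite -ltnS.
pose G n x i := cos be * cos th ^+ n * H k x i.
apply: (@avoid_fc_ge _ _ _ G) => //.
- move=> x i xN; rewrite /G expr0 mulr1 -ler_pdivlMl// mulr1.
  apply: le_trans (hit_le x); rewrite gerBl mulr_ge0 ?surv_ge0//.
  by rewrite mulr_ge0 ?(ltW k0)// exprn_ge0// invr_ge0 ltW.
- move=> n' x Ix; rewrite /G mulr_ge0_le0// /H /= Ix expr0 !mulr1.
  by rewrite subr_le0 hit_le.
- move=> n' x i Ix iM; rewrite /G H_rec// exprSr mulrA -mulrDr.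
  rewrite [leLHS](_ : _ = cos be * cos th ^+ n' * ((H k x.+1 i + H k x.-1 i) / 2)).
    by rewrite mulrA.
  by field; rewrite gt_eqF.
- by move=> n' i; rewrite /G H_boundary mulr1 exprSr mulrA ler_wpM2l.
- move=> n' i; rewrite /G H_boundary mulr1 exprSr mulrA ler_wpM2l//.
  by have [-> _] := H_return k.
Qed.

End Chain.
End Surv.

(** * Spectral expansion of the killed walk *)

Section Spectral.
Variables (R : realType) (N : nat).
Hypothesis N1 : (1 < N)%N.

(** Half of the angle (2k+1) pi / N, whose sine modes vanish at 0 and N and are symmetric under
    reflection. Letting k run over all k < N counts each cosine eigenvalue for both k and N-1-k,
    which turns the sums into sums over equally spaced angles. *)
Let b (k : nat) : R := (k.*2.+1)%:R * (pi / N%:R) / 2.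

Let N0 : (N%:R : R) != 0.
Proof. by rewrite pnatr_eq0 -lt0n ltnW. Qed.

Let N_gt0 : 0 < (N%:R : R).
Proof. by rewrite ltr0n ltnW. Qed.

(** The sum telescopes: 2 sin(phi) cos((2k+1) phi) = sin((2k+2) phi) - sin(2k phi). *)
Lemma sum_cos_odd (phi : R) n :
  (\sum_(k < n) cos ((k.*2.+1)%:R * phi)) * (2 * sin phi) = sin (n.*2%:R * phi).
Proof.
elim: n => [|n IH]; first by rewrite big_ord0 !mul0r sin0.
rewrite big_ord_recr /= mulrDl IH doubleS -(natr1 n.*2.+1) -(natr1 n.*2).
have [y [-> -> ->]] : exists y, [/\ (n.*2%:R + 1 + 1) * phi = y + phi,
    n.*2%:R * phi = y - phi & (n.*2%:R + 1) * phi = y].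
  by exists ((n.*2%:R + 1) * phi); split; ring.
rewrite sinB sinD; ring.
Qed.

Lemma sin_natpi n : sin (n%:R * pi) = 0 :> R.
Proof.
elim: n => [|n IH]; first by rewrite mul0r sin0.
by rewrite -natr1 mulrDl mul1r sinDpi IH oppr0.
Qed.

Let sum_cos_b m : (0 < m < N)%N -> \sum_(k < N) cos (2 * b k * m%:R) = 0.
Proof.
case/andP=> m0 mN; set phi : R := pi * m%:R / N%:R.
have s0 : 0 < sin phi.
  apply: sin_gt0_pi; rewrite /phi divr_gt0 ?mulr_gt0 ?pi_gt0 ?ltr0n ?(ltnW N1)//=.
  by rewrite ltr_pdivrMr// ltr_pM2l ?pi_gt0// ltr_nat.
have := sum_cos_odd phi N.
rewrite (_ : N.*2%:R * phi = (2 * m)%:R * pi); last first.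
  by rewrite -muln2 !natrM /phi; field; exact: N0.
rewrite sin_natpi => /eqP; rewrite mulf_eq0 mulf_eq0 (gt_eqF s0) pnatr_eq0 /= !orbF.
move=> /eqP sum0; rewrite -[RHS]sum0; apply: eq_bigr => k _; congr cos; rewrite /b /phi; field.
exact: N0.
Qed.

Let b_gt0 k : (k < N)%N -> 0 < sin (b k).
Proof.
move=> kN; apply: sin_gt0_pi; rewrite /b divr_gt0 ?mulr_gt0 ?divr_gt0 ?pi_gt0 ?invr_gt0 ?N_gt0//=.
rewrite mulrA ltr_pdivrMr// ltr_pdivrMr// -mulrA mulrC ltr_pM2l ?pi_gt0//.
by rewrite mulrC -natrM ltr_nat; lia.
Qed.

(** The factor cot(b k) is the inner product of the constant 1 with the k-th sine mode. *)
Let D k x : R := cos (b k) / sin (b k) * sin (2 * b k * x%:R).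

(** This expands the constant initial value 1. At x = 1 the terms are 1 + cos(2 b k); each increment
    in x is a sum of two cosines, and these sum to zero over k. *)
Let sum_D x : (0 < x < N)%N -> \sum_(k < N) D k x = N%:R.
Proof.
case: x => // x /=; elim: x => [|x IH] xN.
  transitivity (\sum_(k < N) (cos (2 * b k * 1%:R) + 1)).
    apply: eq_bigr => k _; rewrite /D !mulr1 !mulr_natl sin_mulr2n cos_mulr2n.
    by field; rewrite gt_eqF// b_gt0.
  by rewrite big_split /= sum_cos_b//= sumr_const card_ord add0r.
rewrite -[RHS](IH (ltnW xN)); apply/eqP; rewrite -subr_eq0 -sumrB; apply/eqP.
transitivity (\sum_(k < N) (cos (2 * b k * x.+2%:R) + cos (2 * b k * x.+1%:R))); last first.
  by rewrite big_split /= !sum_cos_b ?addr0//= ltnW.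
apply: eq_bigr => k _; rewrite /D -(natr1 x.+1) /=.
move: (x.+1%:R) => y.
have [w [-> ->]] : exists w, 2 * b k * (y + 1) = w + b k /\ 2 * b k * y = w - b k.
  by exists (2 * b k * y + b k); split; ring.
move: (b_gt0 (ltn_ord k)); move: (b k) => v v0.
by rewrite sinB sinD cosB cosD; field; rewrite gt_eqF.
Qed.

(** Each mode is an eigenfunction of averaging over neighbours with eigenvalue cos(2 b k) and
    vanishes on the boundary, so both sides obey the same recursion from the same initial value. *)
Lemma surv_spectral i x : (x <= N)%N ->
  surv R N i x = N%:R^-1 * \sum_(k < N) D k x * cos (2 * b k) ^+ i.
Proof.
have bd j y : ~~ interior_site N y -> (y <= N)%N ->
    N%:R^-1 * \sum_(k < N) D k y * cos (2 * b k) ^+ j = 0.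
  move=> Iy yN; rewrite big1 ?mulr0// => k _; rewrite /D.
  have -> : sin (2 * b k * y%:R) = 0; last by rewrite mulr0 mul0r.
  move: Iy; rewrite /interior_site negb_and -!leqNgt leqn0 => /orP[/eqP ->|Ny].
    by rewrite mulr0 sin0.
  have -> : y = N by apply/eqP; rewrite eqn_leq yN.
  rewrite (_ : _ * _ = (k.*2.+1)%:R * pi) ?sin_natpi//; rewrite /b; field.
  exact: N0.
elim: i x => [|i IH] x xN; (case: (boolP (interior_site N x)) => Ix; last first).
- by rewrite surv_boundary// bd.
- under eq_bigr do rewrite expr0 mulr1.
  by rewrite sum_D// mulVf//= Ix.
- by rewrite surv_boundary// bd.
- rewrite survS// !IH ?(leq_trans (leq_pred _))//; last by case/andP: Ix.
  rewrite -mulrDr -big_split /= -mulrA mulr_suml; congr (_ * _).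
  apply: eq_bigr => k _; case: x Ix {xN} => // x _; rewrite /D /= -(natr1 x.+1) -(natr1 x).
  have [w [-> -> ->]] : exists w, [/\ 2 * b k * (x%:R + 1 + 1) = w + 2 * b k,
      2 * b k * x%:R = w - 2 * b k & 2 * b k * (x%:R + 1) = w].
    by exists (2 * b k * (x%:R + 1)); split; ring.
  rewrite exprSr sinB sinD.
  by move: (sin (b k))^-1 => r; field.
Qed.

Lemma surv1_spectral i : surv R N i 1 =
  N%:R^-1 * \sum_(k < N) (1 + cos ((k.*2.+1)%:R * (pi / N%:R))) *
                         cos ((k.*2.+1)%:R * (pi / N%:R)) ^+ i.
Proof.
rewrite surv_spectral ?(ltnW N1)//; congr (_ * _); apply: eq_bigr => k _.
have bE : 2 * b k = (k.*2.+1)%:R * (pi / N%:R) by rewrite /b; field; exact: N0.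
rewrite /D mulr1 bE -bE; congr (_ * _).
rewrite mulr_natl sin_mulr2n cos_mulr2n; field.
by rewrite gt_eqF// b_gt0.
Qed.

End Spectral.

(** * Two-sided bounds for survival from site 1 *)

Section SurvBounds.
Variables (R : realType) (N : nat).
Hypothesis N1 : (1 < N)%N.

Let x : R := pi / N%:R.
Let a (k : nat) : R := (k.*2.+1)%:R * x.

Let N_gt0 : 0 < (N%:R : R).
Proof. by rewrite ltr0n ltnW. Qed.

Let cos_a_sym k : (k < N)%N -> cos (a (N - k.+1)) = cos (a k).
Proof.
move=> kN; rewrite -[in RHS]cosN -[RHS]cosD2pi; congr cos.
rewrite /a /x (_ : ((N - k.+1).*2.+1)%:R = N%:R *+ 2 - (k.*2.+1)%:R :> R); last first.
  apply: (addIr (k.*2.+1)%:R); rewrite subrK -natrD mulr2n -natrD.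
  by congr (_%:R); lia.
by rewrite !mulr2n; field; rewrite gt_eqF.
Qed.

(* For even M every term of the spectral sum is nonnegative, so the two extreme
   ones give a lower bound; odd M follow since surv is nonincreasing in time. The
   upper bounds below use odd M, for which the terms with negative cosine drop. *)
Lemma surv1_ge_even M : ~~ odd M ->
  2 / N%:R * (1 + cos x) * cos x ^+ M <= surv R N M 1.
Proof.
move=> oM; rewrite surv1_spectral// -/x.
have t0 k : 0 <= (1 + cos (a k)) * cos (a k) ^+ M.
  apply: mulr_ge0; last by rewrite exprn_even_ge0.
  by have := cos_geN1 (a k); lra.
rewrite [leRHS]mulrC ler_pdivlMr//.
have -> : 2 / N%:R * (1 + cos x) * cos x ^+ M * N%:R =
    (1 + cos x) * cos x ^+ M + (1 + cos x) * cos x ^+ M.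
  by field; rewrite gt_eqF.
have a0 : cos (a 0) = cos x by rewrite /a mul1r.
have aN : cos (a N.-1) = cos x by rewrite -a0 -(cos_a_sym (ltnW N1)) subn1.
have NN : (N.-1 < N)%N by rewrite prednK// ltnW.
rewrite (bigD1 (Ordinal (ltnW N1)))//= (bigD1 (Ordinal NN))/=; last first.
  by rewrite -val_eqE /= -lt0n -ltnS prednK// ltnW.
rewrite -/(a 0) a0 -/(a N.-1) aN addrA lerDl sumr_ge0// => k _.
exact: t0.
Qed.

Lemma surv1_ge M : 2 / N%:R * (1 + cos x) * cos x ^+ M.+1 <= surv R N M 1.
Proof.
have x0 : 0 < x by rewrite divr_gt0 ?pi_gt0.
have xpi : x <= pi / 2 by rewrite ler_pM2l ?pi_gt0// lef_pV2 ?posrE// ler_nat.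
have c0 : 0 <= cos x.
  by rewrite cos_ge0_pihalf// xpi andbT (le_trans _ (ltW x0))// oppr_le0 divr_ge0// pi_ge0.
case oM: (odd M).
  by apply: (le_trans (surv1_ge_even _)); [rewrite /= oM|rewrite surv_nonincr].
apply: le_trans (surv1_ge_even (negbT oM)).
by rewrite ler_wpM2l ?ler_wiXn2l ?cos_le1.
Qed.

Hypothesis N6 : (6 <= N)%N.

Let x0 : 0 < x. Proof. by rewrite divr_gt0 ?pi_gt0. Qed.

Let x6 : x * 6 <= pi.
Proof.
by rewrite /x mulrAC ler_pdivrMr// ler_pM2l ?pi_gt0// ler_nat.
Qed.

Let cx0 : 0 < cos x.
Proof. by apply: cos_gt0_pihalf; have := x6; have := x0; lra. Qed.

Let cx1 : cos x < 1.
Proof.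
rewrite -cos0 ltr_cos ?in_itv/= ?lexx ?pi_ge0//; have := x6; have := x0; lra.
Qed.

Let cos3x_ge0 : 0 <= cos (3 * x).
Proof. by rewrite cos_ge0_pihalf//; have := x6; have := x0; lra. Qed.

(** This bounds the first ratio cos(3x) / cos(x) by cos(x). With c = cos x, the difference factors
    as c (1 - c) (4c + 3). *)
Let cos3x_le : cos (3 * x) <= cos x ^+ 2.
Proof.
have -> : cos (3 * x) = 4 * cos x ^+ 3 - 3 * cos x.
  rewrite (_ : 3 * x = x *+ 2 + x); last by rewrite mulr2n; ring.
  rewrite cosD cos_mulr2n sin_mulr2n !mulr2n.
  have -> : (cos x * sin x + cos x * sin x) * sin x = 2 * cos x * sin x ^+ 2 by ring.
  by rewrite sin2cos2; ring.
have := cx1; have := cx0; move: (cos x) => c c0 c1; rewrite -subr_ge0.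
have -> : c ^+ 2 - (4 * c ^+ 3 - 3 * c) = c * (1 - c) * (4 * c + 3) by ring.
by rewrite !mulr_ge0//; lra.
Qed.

(** Geometric decay: cos(3x) cos(a k) - cos(a (k+1)) cos(x) = 2 sin(2kx) sin(x) cos(x) >= 0 as long
    as 2kx <= pi, so no later ratio exceeds the first one. *)
Let cos_a_le_half k : (k.*2 <= N.+1)%N -> cos (a k) <= cos x * cos x ^+ k.
Proof.
elim: k => [|k IH] kN; first by rewrite /a mul1r expr0 mulr1.
have kN' : (k.*2 <= N)%N by lia.
suff h : cos (a k.+1) * cos x <= cos (3 * x) * cos (a k).
  rewrite -(ler_pM2r cx0) (le_trans h)//.
  apply: (@le_trans _ _ (cos (3 * x) * (cos x * cos x ^+ k))).
    by rewrite ler_wpM2l// IH// leqW.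
  rewrite (_ : _ * _ ^+ k.+1 * _ = cos x ^+ 2 * (cos x * cos x ^+ k)); last first.
    by rewrite exprS; ring.
  by rewrite ler_wpM2r// -exprS exprn_ge0// ltW.
rewrite -subr_ge0.
have kx : 0 <= k.*2%:R * x <= pi.
  rewrite mulr_ge0 ?(ltW x0)//= /x mulrCA ger_pMr ?pi_gt0//.
  by rewrite ler_pdivrMr// mul1r ler_nat.
have -> : a k = k.*2%:R * x + x by rewrite /a -natr1; ring.
have -> : a k.+1 = k.*2%:R * x + x + x + x.
  by rewrite /a doubleS -(natr1 k.*2.+2) -(natr1 k.*2.+1) -(natr1 k.*2); ring.
have -> : 3 * x = x + x + x by ring.
move: (k.*2%:R * x) kx => y ypi.
have -> : cos (x + x + x) * cos (y + x) - cos (y + x + x + x) * cos x =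
    2 * sin y * (cos x * sin x).
  have E : sin (x + x + x - x) = 2 * (cos x * sin x) by rewrite addrK sinD; ring.
  have -> : y + x + x + x = y + (x + x + x) by ring.
  have -> : 2 * sin y * (cos x * sin x) = sin y * sin (x + x + x - x) by rewrite E; ring.
  move: (x + x + x) => w.
  by rewrite sinB !cosD; ring.
by rewrite !mulr_ge0// ?sin_ge0_pi// ?(ltW cx0)//; have := x6; have := x0; lra.
Qed.

Let cos_a_le k : (k < N)%N -> cos (a k) <= cos x * cos x ^+ k \/
  cos (a k) <= cos x * cos x ^+ (N - k.+1).
Proof.
move=> kN; case: (leqP k.*2 N.+1) => kN2; first by left; exact: cos_a_le_half.
by right; rewrite -cos_a_sym//; apply: cos_a_le_half; lia.
Qed.

(** Terms with negative cosine are dropped, and 1 + cos is bounded by 2. The rest decays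
    geometrically with ratio cos(x)^M from both ends of the sum, whence the factor 4 and the
    denominator. *)
Lemma surv1_le_odd M : odd M ->
  surv R N M 1 <= 4 / N%:R * cos x ^+ M / (1 - cos x ^+ M).
Proof.
move=> oM; rewrite surv1_spectral// -/x.
set r := cos x ^+ M.
have r0 : 0 <= r by rewrite exprn_ge0// (ltW cx0).
have r1 : r < 1 by rewrite exprn_ilt1 ?(ltW cx0) ?cx1//; apply: contraTN oM => /eqP ->.
have cM0 : 0 <= cos x ^+ M by rewrite exprn_ge0// ltW.
rewrite mulrC ler_pdivrMr//.
(* Adding both nonnegative alternatives of [cos_a_le] gives one bound valid for every k. *)
apply: (@le_trans _ _ (\sum_(k < N) 2 * cos x ^+ M * (r ^+ k + r ^+ (N - k.+1)))).
  apply: ler_sum => k _; rewrite -/(a k).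
  have rk j : 0 <= r ^+ j by rewrite exprn_ge0.
  have [c0|c0] := leP (cos (a k)) 0.
    apply: (@le_trans _ _ 0); last by rewrite !mulr_ge0// addr_ge0.
    apply: mulr_ge0_le0; last by rewrite exprn_odd_le0.
    by have := cos_geN1 (a k); lra.
  apply: (@le_trans _ _ (2 * cos (a k) ^+ M)).
    by rewrite ler_wpM2r ?exprn_ge0 ?(ltW c0)//; have := cos_le1 (a k); lra.
  rewrite -mulrA ler_wpM2l// mulrDr.
  have H j : cos (a k) <= cos x * cos x ^+ j -> cos (a k) ^+ M <= cos x ^+ M * r ^+ j.
    move=> h; rewrite /r exprAC -exprMn lerXn2r ?nnegrE ?(ltW c0)//.
    by rewrite mulr_ge0 ?(ltW cx0)// exprn_ge0// (ltW cx0).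
  case: (cos_a_le (ltn_ord k)) => /H h; apply: (le_trans h).
    by rewrite lerDl mulr_ge0.
  by rewrite lerDr mulr_ge0.
rewrite -mulr_sumr big_split /=.
have -> : \sum_(k < N) r ^+ (N - k.+1) = \sum_(k < N) r ^+ k.
  by rewrite [RHS](reindex_inj rev_ord_inj).
have gs : \sum_(k < N) r ^+ k <= (1 - r)^-1.
  rewrite -[leRHS]mul1r ler_pdivlMr ?subr_gt0//.
  have := subrX1 r N; set S := \sum_(_ < _) _ => rN.
  have : 0 <= r ^+ N by rewrite exprn_ge0.
  by lra.
rewrite (_ : 4 / N%:R * _ / _ * _ = 2 * cos x ^+ M * ((1 - r)^-1 + (1 - r)^-1)).
  by rewrite ler_wpM2l ?lerD// mulr_ge0.
have r1' : 1 - r != 0 by rewrite subr_eq0 gt_eqF.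
by rewrite -/r; field; rewrite r1' gt_eqF.
Qed.

(** One of M+1 and M+2 is odd, and the bound with exponent M+1 covers both cases. *)
Lemma surv1_le M : surv R N M.+2 1 <=
  4 / N%:R * cos x ^+ M.+1 / (1 - cos x ^+ M.+1).
Proof.
have g0 := (ltW cx0); have g1 := cx1.
case oM: (odd M); last first.
  by apply: le_trans (surv1_le_odd _); rewrite ?surv_nonincr//= oM.
apply: (le_trans (surv1_le_odd _)); first by rewrite /= oM.
have h n : 0 < 1 - cos x ^+ n.+1 by rewrite subr_gt0 exprn_ilt1.
apply: ler_pM.
- by rewrite mulr_ge0 ?exprn_ge0 ?divr_ge0 ?(ltW cx0).
- by rewrite invr_ge0 ltW.
- by rewrite ler_wpM2l ?divr_ge0 ?ler_wiXn2l ?cos_le1// (ltW cx0).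
- rewrite lef_pV2 ?posrE ?h// lerB//.
  by rewrite ler_wiXn2l// ltW.
Qed.

End SurvBounds.

(** * Powers of cosines of small angles *)

Section CosLimits.
Variable R : realType.
Implicit Types (th : nat -> R) (k : nat -> nat).

Lemma cvg_near_eq (T : Type) (F : set_system T) (FF : Filter F) (f g : T -> R) (l : R) :
  (\forall x \near F, f x = g x) -> f x @[x --> F] --> l -> g x @[x --> F] --> l.
Proof. by move=> fg; apply: cvg_trans; apply: near_eq_cvg; apply: filterS fg. Qed.

Lemma cvg_sin_div_id : sin x / x @[x --> (0 : R)^'] --> (1 : R).
Proof.
have h := @derivable_sin R 0; have e : 'D_1 (@sin R) 0 = 1.
  by rewrite derive_val cos0.
rewrite -e; apply: cvg_trans h; apply: near_eq_cvg; near=> x.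
by rewrite /= sin0 subr0 addr0 /GRing.scale /= mulr1 mulrC.
Unshelve. all: by end_near. Qed.

Lemma cvg_cos0 : cos x @[x --> (0 : R)^'] --> (1 : R).
Proof. by have /continuous_withinNx := @continuous_cos R 0; rewrite cos0. Qed.

Lemma near_cos_gt0 : \forall x \near (0 : R)^', 0 < cos x.
Proof. by apply: (cvgr_gt 1 cvg_cos0). Qed.

Lemma cvg_tan_div_id : tan x / x @[x --> (0 : R)^'] --> (1 : R).
Proof.
have h : sin x / x * (cos x)^-1 @[x --> (0 : R)^'] --> (1 : R).
  rewrite -[X in _ --> X]mulr1 -[X in _ * X]invr1.
  by apply: cvgM cvg_sin_div_id _; exact: cvgV cvg_cos0.
apply: cvg_near_eq h; near=> x.
by rewrite /tan /= mulrAC.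
Unshelve. all: by end_near. Qed.

Lemma cvg_cosB1_div_sqr :
  (cos x - 1) / x ^+ 2 @[x --> (0 : R)^'] --> (- 2^-1 : R).
Proof.
have h1 : (1 + cos x)^-1 @[x --> (0 : R)^'] --> (2^-1 : R).
  apply: cvgV; first by rewrite pnatr_eq0.
  by rewrite (_ : 2 = 1 + 1)//; apply: cvgD; [exact: cvg_cst|exact: cvg_cos0].
have h : - (sin x / x * (sin x / x) * (1 + cos x)^-1) @[x --> (0 : R)^']
    --> (- 2^-1 : R).
  apply: cvgN; rewrite -[X in _ --> X]mul1r -[X in X * _]mulr1.
  by apply: cvgM h1; apply: cvgM; exact: cvg_sin_div_id.
apply: cvg_near_eq h; near=> x.
have cx : 0 < cos x by near: x; exact: near_cos_gt0.
have x0 : x != 0 by near: x; exact: nbhs_dnbhs_neq.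
rewrite /= !mulf_div -!expr2 sin2cos2; field.
by rewrite x0 gt_eqF// addr_gt0.
Unshelve. all: by end_near. Qed.

(** Squeeze from 1 - 1/c <= ln c <= c - 1 at c = cos x. *)
Lemma cvg_ln_cos_div_sqr :
  ln (cos x) / x ^+ 2 @[x --> (0 : R)^'] --> (- 2^-1 : R).
Proof.
have h : (cos x - 1) / x ^+ 2 * (cos x)^-1 @[x --> (0 : R)^'] --> (- 2^-1 : R).
  rewrite -[X in _ --> X]mulr1 -[X in _ * X]invr1.
  by apply: cvgM cvg_cosB1_div_sqr _; exact: cvgV cvg_cos0.
apply: squeeze_cvgr h cvg_cosB1_div_sqr; near=> x.
have cx : 0 < cos x by near: x; exact: near_cos_gt0.
have x0 : x != 0 by near: x; exact: nbhs_dnbhs_neq.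
have x2 : 0 <= (x ^+ 2)^-1 by rewrite invr_ge0 sqr_ge0.
have l (y : R) : 0 < y -> ln y <= y - 1.
  by move=> y0; rewrite -[in leLHS](subrKC 1 y) le_ln1Dx//; lra.
apply/andP; split; last by rewrite ler_wpM2r// l.
rewrite mulrAC ler_wpM2r// mulrBl divff ?gt_eqF// mul1r lerBlDr -lerBlDl.
by have := l (cos x)^-1; rewrite invr_gt0 => /(_ cx); rewrite lnV ?posrE//; lra.
Unshelve. all: by end_near. Qed.

Lemma cvg_dnbhs0 th : (\forall n \near \oo, 0 < th n) -> th n @[n --> \oo] --> (0 : R) ->
  th n @[n --> \oo] --> (0 : R)^'.
Proof.
move=> th_gt0 th0 A /= /th0 hA; near=> n.
have := near hA n; apply=> //.
by rewrite gt_eqF//; near: n.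
Unshelve. all: by end_near. Qed.

(** The exponent [j] is quantified inside the filter, so exponents depending on [n] may be
    substituted. *)
Lemma cosX_expR th : (\forall n \near \oo, 0 < th n) -> th n @[n --> \oo] --> (0 : R) ->
  \forall n \near \oo, forall j : nat, cos (th n) ^+ j =
    expR (th n ^+ 2 * j%:R * (ln (cos (th n)) / th n ^+ 2)).
Proof.
move=> th_gt0 th0; have thd := cvg_dnbhs0 th_gt0 th0.
near=> n => j.
have cx : 0 < cos (th n) by near: n; exact: (thd _ near_cos_gt0).
have t0 : 0 < th n by near: n.
rewrite (_ : _ * _ = j%:R * ln (cos (th n))); last by field; rewrite gt_eqF.
by rewrite expRM_natl lnK.
Unshelve. all: by end_near. Qed.

Lemma cvg_cosX th k (l : R) : (\forall n \near \oo, 0 < th n) ->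
  th n @[n --> \oo] --> (0 : R) -> th n ^+ 2 * (k n)%:R @[n --> \oo] --> l ->
  cos (th n) ^+ k n @[n --> \oo] --> expR (- (l / 2)).
Proof.
move=> th_gt0 th0 thk; have thd := cvg_dnbhs0 th_gt0 th0.
have h : expR (th n ^+ 2 * (k n)%:R * (ln (cos (th n)) / th n ^+ 2)) @[n --> \oo]
    --> expR (- (l / 2)).
  apply: continuous_cvg; first exact: continuous_expR.
  rewrite -mulrN; apply: cvgM => //.
  exact: (cvg_comp _ _ thd cvg_ln_cos_div_sqr).
apply: cvg_near_eq h; near=> n.
by apply/esym; move: (k n); near: n; exact: cosX_expR.
Unshelve. all: by end_near. Qed.

Lemma cosX_le th : (\forall n \near \oo, 0 < th n) -> th n @[n --> \oo] --> (0 : R) ->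
  \forall n \near \oo, forall j : nat, 0 <= cos (th n) ^+ j <= expR (- (th n ^+ 2 * j%:R / 4)).
Proof.
move=> th_gt0 th0; have thd := cvg_dnbhs0 th_gt0 th0.
near=> n => j; have -> : cos (th n) ^+ j =
    expR (th n ^+ 2 * j%:R * (ln (cos (th n)) / th n ^+ 2)).
  by move: j; near: n; exact: cosX_expR.
rewrite expR_ge0 ler_expR /= -mulrN.
apply: ler_wpM2l; first by apply: mulr_ge0 => //; exact: sqr_ge0.
apply/ltW; near: n.
have h : ln (cos (th n)) / th n ^+ 2 @[n --> \oo] --> (- 2^-1 : R).
  exact: (cvg_comp _ _ thd cvg_ln_cos_div_sqr).
(* The limit -1/2 lies strictly below -1/4, the rate claimed in the bound. *)
by apply: (cvgr_lt _ h); rewrite ltrN2 ltf_pV2 ?posrE// ltr_nat.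
Unshelve. all: by end_near. Qed.

(** Since e^y = (e^(y/2))^2 >= (1 + y/2)^2. The quadratic order is what makes y e^(-y) vanish in
    [cvg_aM]. *)
Lemma expRN_le_sqr (y : R) : 0 < y -> expR (- y) <= 4 / y ^+ 2.
Proof.
move=> y0; rewrite expRN -[leRHS]invrK lef_pV2 ?posrE ?expR_gt0 ?invr_gt0 ?divr_gt0 ?exprn_gt0//.
rewrite invf_div (_ : y = 2%:R * (y / 2)); last by field.
rewrite expRM_natl.
apply: (@le_trans _ _ ((1 + y / 2) ^+ 2)).
  rewrite (_ : _ / 4 = (y / 2) ^+ 2); last by field.
  by rewrite lerXn2r ?nnegrE; lra.
by rewrite lerXn2r ?nnegrE ?expR_ge0 ?expR_ge1Dx//; lra.
Qed.

Lemma cvg_cosX0 th k : (\forall n \near \oo, 0 < th n) ->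
  th n @[n --> \oo] --> (0 : R) -> th n ^+ 2 * (k n)%:R @[n --> \oo] --> +oo ->
  cos (th n) ^+ k n @[n --> \oo] --> (0 : R).
Proof.
move=> th_gt0 th0 thk.
have inv0 : (th n ^+ 2 * (k n)%:R)^-1 @[n --> \oo] --> (0 : R).
  by apply/(gtr0_cvgV0 (cvgry_gt thk 0)).
have h : (th n ^+ 2 * (k n)%:R)^-1 * (th n ^+ 2 * (k n)%:R)^-1 * 64
    @[n --> \oo] --> (0 * 0 * 64 : R).
  by apply: cvgMr_tmp; apply: cvgM.
rewrite !mul0r in h; apply: squeeze_cvgr (cvg_cst 0) h; near=> n.
have y0 : 0 < th n ^+ 2 * (k n)%:R by near: n; exact: cvgry_gt thk 0.
have /andP[c0 c1] : 0 <= cos (th n) ^+ k n <= expR (- (th n ^+ 2 * (k n)%:R / 4)).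
  by move: (k n); near: n; exact: cosX_le.
rewrite c0 (le_trans c1)// (le_trans (expRN_le_sqr _)) ?divr_gt0//.
move: (th n ^+ 2 * (k n)%:R) y0 => y y0.
by rewrite [leLHS](_ : _ = y^-1 * y^-1 * 64)//; field; rewrite gt_eqF.
Unshelve. all: by end_near. Qed.

End CosLimits.

(** * Asymptotics along M *)

Section Asymptotics.
Variables (R : realType) (N : nat -> nat).
Hypothesis N_cvg : N M @[M --> \oo] --> \oo.
Hypothesis MN_cvg : (M%:R / (N M)%:R ^+ 2 : R) @[M --> \oo] --> +oo.

Local Notation x := (fun M => pi / (N M)%:R : R).
Local Notation c := (fun M => cos (pi / (N M)%:R) : R).
Local Notation a := (fun M => 4 / (N M)%:R ^+ 2 * cos (pi / (N M)%:R) ^+ M : R).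

Lemma near_N_ge k : \forall M \near \oo, (k <= N M)%N.
Proof. exact: (N_cvg (nbhs_infty_ge k)). Qed.

Lemma near_NR_gt0 : \forall M \near \oo, 0 < (N M)%:R :> R.
Proof. by apply: filterS (near_N_ge 1) => M; rewrite ltr0n. Qed.

Lemma near_ge k : \forall M \near \oo, (k <= M)%N.
Proof. exact: nbhs_infty_ge. Qed.

Lemma near_x_gt0 : \forall M \near \oo, 0 < x M.
Proof. by apply: filterS near_NR_gt0 => M N0; rewrite divr_gt0 ?pi_gt0. Qed.

Lemma cvg_x : x M @[M --> \oo] --> (0 : R).
Proof.
have h : (N M)%:R^-1 @[M --> \oo] --> (0 : R).
  by apply/(gtr0_cvgV0 near_NR_gt0); apply/cvgrnyP.
by rewrite -[X in _ --> X](mulr0 pi); apply: cvgMl_tmp.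
Qed.

Lemma cvg_c : c M @[M --> \oo] --> (1 : R).
Proof.
by rewrite -[X in _ --> X]cos0; apply: continuous_cvg; [exact: continuous_cos|exact: cvg_x].
Qed.

Lemma x2ME M : x M ^+ 2 * M%:R = pi ^+ 2 * (M%:R / (N M)%:R ^+ 2).
Proof. by rewrite expr_div_n; ring. Qed.

Lemma cvg_x2M : x M ^+ 2 * M%:R @[M --> \oo] --> +oo.
Proof.
rewrite (_ : (fun M => _) = fun M => pi ^+ 2 * (M%:R / (N M)%:R ^+ 2)); last first.
  by apply/funext => M; exact: x2ME.
have p0 : 0 < pi ^+ 2 :> R by rewrite exprn_gt0// pi_gt0.
exact: (cvg_comp _ _ MN_cvg (gt0_cvgMry p0 cvg_id)).
Qed.

Lemma cvg_cM : c M ^+ M @[M --> \oo] --> (0 : R).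
Proof. exact: (cvg_cosX0 near_x_gt0 cvg_x cvg_x2M). Qed.

Lemma near_c_gt0 : \forall M \near \oo, 0 < c M.
Proof. exact: (cvgr_gt _ cvg_c). Qed.

Lemma near_a_gt0 : \forall M \near \oo, 0 < a M.
Proof.
near=> M; rewrite mulr_gt0 ?divr_gt0 ?exprn_gt0//; near: M.
- exact: near_NR_gt0.
- exact: near_c_gt0.
Unshelve. all: by end_near. Qed.

(** A full counter of M steps is negligible on the time scale 1/a: with y = M / N^2 the product is 4
    y cos^M(pi/N), at most 4 y exp(- pi^2 y / 4), and y tends to infinity. *)
Lemma cvg_aM : a M * M%:R @[M --> \oo] --> (0 : R).
Proof.
have h : (256 / pi ^+ 2) * (x M ^+ 2 * M%:R)^-1 @[M --> \oo] --> (0 : R).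
  rewrite -(mulr0 (256 / pi ^+ 2)); apply: cvgMl_tmp.
  by apply/(gtr0_cvgV0 (cvgry_gt cvg_x2M 0)); exact: cvg_x2M.
apply: squeeze_cvgr (cvg_cst 0) h; near=> M.
have y0 : 0 < M%:R / (N M)%:R ^+ 2 :> R by near: M; exact: cvgry_gt MN_cvg 0.
have /andP[c0 c1] : 0 <= c M ^+ M <= expR (- (x M ^+ 2 * M%:R / 4)).
  suff : forall j : nat, 0 <= c M ^+ j <= expR (- (x M ^+ 2 * j%:R / 4)) by apply.
  by near: M; exact: (cosX_le near_x_gt0 cvg_x).
have a0 : 0 < a M by near: M; exact: near_a_gt0.
rewrite mulr_ge0 ?(ltW a0)//=.
have -> : a M * M%:R = 4 * (M%:R / (N M)%:R ^+ 2) * c M ^+ M by ring.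
move: c0 c1; rewrite x2ME; move: (_ / _ ^+ 2) y0 => y y0 c0 c1.
have p0 : 0 < pi ^+ 2 :> R by rewrite exprn_gt0// pi_gt0.
apply: (@le_trans _ _ (4 * y * (4 / (pi ^+ 2 * y / 4) ^+ 2))).
  rewrite ler_wpM2l ?mulr_ge0 ?(ltW y0)// (le_trans c1)// expRN_le_sqr//.
  by rewrite divr_gt0// mulr_gt0.
move: (pi ^+ 2) p0 => p p0; rewrite le_eqVlt; apply/orP; left; apply/eqP; field.
by rewrite (gt_eqF y0) (gt_eqF p0).
Unshelve. all: by end_near. Qed.

Lemma cvg_a : a M @[M --> \oo] --> (0 : R).
Proof.
apply: squeeze_cvgr (cvg_cst 0) cvg_aM; near=> M.
have a0 : 0 < a M by near: M; exact: near_a_gt0.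
rewrite (ltW a0) ler_peMr ?(ltW a0)// ler1n.
by near: M; exact: near_ge.
Unshelve. all: by end_near. Qed.

(** Here [a * N] is (4/N) cos^M(pi/N), the leading spectral term; [surv1_ge] and [surv1_le] differ
    from it by factors tending to 1. *)
Lemma cvg_surv1 :
  surv R (N M) M 1 / (a M * (N M)%:R) @[M --> \oo] --> (1 : R).
Proof.
have h1 : (1 + c M) / 2 * c M @[M --> \oo] --> (1 : R).
  rewrite [X in _ --> X](_ : 1 = (1 + 1) / 2 * 1 :> R); last by field.
  apply: cvgM cvg_c; apply: cvgMr_tmp; apply: cvgD cvg_c; exact: cvg_cst.
have h2 : (c M)^-1 / (1 - c M ^+ M * (c M)^-1) @[M --> \oo] --> (1 : R).
  have cV : (c M)^-1 @[M --> \oo] --> (1^-1 : R) by apply: cvgV cvg_c.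
  rewrite [X in _ --> X](_ : 1 = 1^-1 / (1 - 0 * 1^-1) :> R); last first.
    by rewrite mul0r subr0 invr1 mulr1.
  apply: (cvgM cV); apply: cvgV; first by rewrite mul0r subr0.
  by apply: cvgB; [exact: cvg_cst|exact: (cvgM cvg_cM cV)].
apply: squeeze_cvgr h1 h2; near=> M.
have N0 : 0 < (N M)%:R :> R by near: M; exact: near_NR_gt0.
have c0 : 0 < c M by near: M; exact: near_c_gt0.
have cM0 : 0 < c M ^+ M by rewrite exprn_gt0.
have N6 : (6 <= N M)%N by near: M; exact: near_N_ge.
have N1 : (1 < N M)%N by exact: leq_trans N6.
have aE : a M * (N M)%:R = 4 / (N M)%:R * c M ^+ M by field; rewrite gt_eqF.
have aN0 : 0 < a M * (N M)%:R by rewrite aE mulr_gt0 ?divr_gt0.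
rewrite ler_pdivlMr// ler_pdivrMr// aE; apply/andP; split.
  apply: le_trans (surv1_ge R N1 M); rewrite exprSr le_eqVlt; apply/orP; left.
  by apply/eqP; field; rewrite gt_eqF.
have M2 : (2 <= M)%N by near: M; exact: near_ge.
have := surv1_le R N1 N6 M.-2.
have -> : M.-2.+2 = M by lia.
have -> : M.-2.+1 = M.-1 by lia.
move=> /le_trans; apply.
have -> : c M ^+ M.-1 = c M ^+ M * (c M)^-1.
  suff E j : (0 < j)%N -> c M ^+ j.-1 = c M ^+ j * (c M)^-1 by exact: E (ltnW M2).
  by case: j => // j _; rewrite exprSr mulfK// gt_eqF.
rewrite le_eqVlt; apply/orP; left; apply/eqP.
by move: (_ - _)^-1 => w; ring.
Unshelve. all: by end_near. Qed.

(** * The angle attached to a decay rate [ka] *)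

Section Theta.
Variable ka : R.
Hypothesis ka_gt0 : 0 < ka.

Local Notation th := (fun M => Num.sqrt (2 * ka * a M)).
Local Notation be := (fun M => th M * (N M)%:R / 2).

Lemma near_th_gt0 : \forall M \near \oo, 0 < th M.
Proof.
by apply: filterS near_a_gt0 => M a0; rewrite sqrtr_gt0 (pmulr_lgt0 _ a0) mulr_gt0.
Qed.

Lemma near_th2 : \forall M \near \oo, th M ^+ 2 = 2 * ka * a M.
Proof.
by apply: filterS near_a_gt0 => M a0; rewrite sqr_sqrtr// (pmulr_lge0 _ a0) mulr_ge0// ltW.
Qed.

Lemma cvg_th : th M @[M --> \oo] --> (0 : R).
Proof.
rewrite -[X in _ --> X](sqrtr0 R) -[X in _ --> Num.sqrt X](mulr0 (2 * ka)).
by apply: continuous_cvg; [exact: sqrt_continuous|apply: cvgMl_tmp; exact: cvg_a].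
Qed.

(** The factors N cancel in be^2 = 2 ka cos^M(pi/N), which tends to 0. *)
Lemma cvg_be : be M @[M --> \oo] --> (0 : R).
Proof.
have h : Num.sqrt (2 * ka * c M ^+ M) @[M --> \oo] --> (0 : R).
  rewrite -[X in _ --> X](sqrtr0 R) -[X in _ --> Num.sqrt X](mulr0 (2 * ka)).
  by apply: continuous_cvg; [exact: sqrt_continuous|apply: cvgMl_tmp; exact: cvg_cM].
apply: cvg_near_eq h; near=> M.
have N0 : 0 < (N M)%:R :> R by near: M; exact: near_NR_gt0.
have -> : 2 * ka * c M ^+ M = 2 * ka * a M * ((N M)%:R / 2) ^+ 2.
  by field; rewrite gt_eqF.
have a0 : 0 < a M by near: M; exact: near_a_gt0.
rewrite sqrtrM; last by rewrite (pmulr_lge0 _ a0) mulr_ge0// ltW.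
by rewrite sqrtr_sqr ger0_norm ?mulrA// divr_ge0// ltW.
Unshelve. all: by end_near. Qed.

Lemma near_be_gt0 : \forall M \near \oo, 0 < be M.
Proof.
near=> M; rewrite divr_gt0// mulr_gt0//; near: M.
- exact: near_th_gt0.
- exact: near_NR_gt0.
Unshelve. all: by end_near. Qed.

Lemma near_thN : \forall M \near \oo, th M * (N M)%:R < pi.
Proof.
near=> M; rewrite (_ : th M * _ = be M * 2); last by field.
rewrite -ltr_pdivlMr//; near: M.
by apply: (cvgr_lt _ cvg_be); rewrite divr_gt0 ?pi_gt0.
Unshelve. all: by end_near. Qed.

Lemma cvg_cos_be : cos (be M) @[M --> \oo] --> (1 : R).
Proof.
by rewrite -[X in _ --> X]cos0; apply: continuous_cvg; [exact: continuous_cos|exact: cvg_be].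
Qed.

(** To leading order the product of tangents is th * be = th^2 N / 2 = ka a N. Against [cvg_surv1],
    the comparison hypotheses thus reduce to the position of [ka] relative to 1. *)
Lemma cvg_tan_tan :
  tan (th M) * tan (be M) / (a M * (N M)%:R) @[M --> \oo] --> ka.
Proof.
have h : tan (th M) / th M * (tan (be M) / be M) * ka @[M --> \oo] --> 1 * 1 * ka.
  apply: cvgMr_tmp; apply: cvgM.
    exact: (cvg_comp _ _ (cvg_dnbhs0 near_th_gt0 cvg_th) (@cvg_tan_div_id R)).
  exact: (cvg_comp _ _ (cvg_dnbhs0 near_be_gt0 cvg_be) (@cvg_tan_div_id R)).
rewrite !mul1r in h; apply: cvg_near_eq h; near=> M.
have N0 : 0 < (N M)%:R :> R by near: M; exact: near_NR_gt0.
have a0 : 0 < a M by near: M; exact: near_a_gt0.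
have th0 : 0 < th M by near: M; exact: near_th_gt0.
have th2 : th M ^+ 2 = 2 * ka * a M by near: M; exact: near_th2.
move: (th M) th0 th2 => t t0 t2.
have -> : a M = t ^+ 2 / (2 * ka).
  by rewrite t2 [RHS]mulrAC divff ?mul1r// mulf_neq0// gt_eqF.
move: (N M)%:R N0 => n n0.
by move: (tan t) (tan (t * n / 2)) => u v; field; rewrite !gt_eqF.
Unshelve. all: by end_near. Qed.

Lemma cvg_cos_thX (k : nat -> nat) (l : R) :
  a M * (k M)%:R @[M --> \oo] --> l ->
  cos (th M) ^+ k M @[M --> \oo] --> expR (- (ka * l)).
Proof.
move=> akl; rewrite (_ : ka * l = 2 * ka * l / 2); last by field.
apply: cvg_cosX near_th_gt0 cvg_th _.
have h : 2 * ka * (a M * (k M)%:R) @[M --> \oo] --> 2 * ka * l by apply: cvgMl_tmp.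
apply: cvg_near_eq h; near=> M.
have -> : th M ^+ 2 = 2 * ka * a M by near: M; exact: near_th2.
by rewrite mulrA.
Unshelve. all: by end_near. Qed.

End Theta.

End Asymptotics.

(** * Distribution function of the exponential law *)

Lemma exponential_prob_lt0 (R : realType) (r t : R) : t < 0 ->
  exponential_prob r `]-oo, t] = 0%E.
Proof.
move=> t0; apply: integral0_eq => x; rewrite /= in_itv /= => xt.
by rewrite lt0_exponential_pdf// (le_lt_trans xt).
Qed.

Lemma exponential_prob_ge0 (R : realType) (r t : R) : 0 < r -> 0 <= t ->
  exponential_prob r `]-oo, t] = (1 - expR (- r * t))%:E.
Proof.
move=> r0 t0; rewrite /exponential_prob.
have -> : `]-oo, t]%classic = `]-oo, 0[%classic `|` `[0, t]%classic :> set R.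
  apply/seteqP; split => y /=; rewrite !in_itv /=.
    by move=> yt; case: (ltP y 0); [left|right; rewrite yt andbT].
  by case=> [y0|/andP[]//]; rewrite (le_trans (ltW y0)).
rewrite ge0_integral_setU//=; last 3 first.
- by apply/measurable_EFinP; apply: measurable_funTS; exact: measurable_exponential_pdf.
- by move=> y _; rewrite lee_fin exponential_pdf_ge0// ltW.
- apply/disj_setPS => y [] /=; rewrite !in_itv /= => y0 /andP[].
  by rewrite leNgt y0.
rewrite integral0_eq ?add0e; last first.
  by move=> y /=; rewrite in_itv /= => y0; rewrite lt0_exponential_pdf.
(* At t = 0 the interval [0, t] degenerates to a null point. *)
move: t0; rewrite le_eqVlt => /predU1P[<-|t0].
  by rewrite set_itv1 integral_set1 mulr0 expR0 subrr.
by have := exponential_prob_itv0c r t0; rewrite /exponential_prob => ->.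
Qed.

(** * Limit of the survival probabilities *)

Section Limit.
Variables (R : realType) (N : nat -> nat) (z : forall M, fc_state (N M) M).
Hypothesis N_cvg : N M @[M --> \oo] --> \oo.
Hypothesis MN_cvg : (M%:R / (N M)%:R ^+ 2 : R) @[M --> \oo] --> +oo.
Hypothesis y_liminf : (0 < limn_einf (fun M => ((z M).2%:R / M%:R : R)%:E))%E.

Local Notation a := (fun M => 4 / (N M)%:R ^+ 2 * cos (pi / (N M)%:R) ^+ M : R).
Local Notation alive M :=
  (avoid (@fc_trans R (N M) M) (@fc_absorbed (N M) M)).

(** The lower limit is a supremum of tail infima, so some tail infimum is positive; it is finite
    because a real term bounds it above, and it serves as [e]. *)
Lemma near_start_ge : exists2 e : R, 0 < e &
  \forall M \near \oo, e * M%:R <= (z M).2%:R.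
Proof.
move: y_liminf; rewrite limn_einf_lim (cvg_lim _ (@cvg_einfs_sup R _))//.
move=> /ereal_sup_gt[_ [n _ <-]] /= en.
have uE m : (n <= m)%N -> (einfs (fun M => ((z M).2%:R / M%:R : R)%:E) n <=
    ((z m).2%:R / m%:R : R)%:E)%E.
  by move=> nm; apply: ereal_inf_lbound; exists m.
have efin : einfs (fun M => ((z M).2%:R / M%:R : R)%:E) n \is a fin_num.
  rewrite fin_numE; apply/andP; split.
    by apply/eqP => eE; rewrite eE in en.
  by apply/eqP => eE; have := uE n (leqnn n); rewrite eE.
exists (fine (einfs (fun M => ((z M).2%:R / M%:R : R)%:E) n)).
  by rewrite -lte_fin fineK.
near=> M.
have M0 : (0 < M)%N by near: M; exact: nbhs_infty_gt.
rewrite -ler_pdivlMr ?ltr0n// -lee_fin fineK//; apply: uE.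
by near: M; exact: nbhs_infty_ge.
Unshelve. all: by end_near. Qed.

(** The walk leaves the interval before the initial counter runs out, with probability tending to 1.
    In [surv_le_cosX] the angle pi / (2N) fixes the half-angle at pi/4, so the denominator stays
    constant while the power of the cosine vanishes. *)
Lemma cvg_surv_start : surv R (N M) (z M).2 (z M).1 @[M --> \oo] --> (0 : R).
Proof.
pose ph M : R := pi / (N M)%:R / 2.
have ph_gt0 : \forall M \near \oo, 0 < ph M.
  by apply: filterS (near_x_gt0 R N_cvg) => M x0; rewrite divr_gt0.
have ph0 : ph M @[M --> \oo] --> (0 : R).
  by rewrite -(mul0r (2^-1 : R)); apply: cvgMr_tmp; exact: cvg_x.
have [e e0 eM] := near_start_ge.
have phy : ph M ^+ 2 * (z M).2%:R @[M --> \oo] --> +oo.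
  have e4 : 0 < e / 4 by rewrite divr_gt0.
  have h : e / 4 * ((pi / (N M)%:R) ^+ 2 * M%:R) @[M --> \oo] --> +oo.
    exact: (cvg_comp _ _ (cvg_x2M MN_cvg) (gt0_cvgMry e4 cvg_id)).
  apply: ger_cvgy h; near=> M; rewrite /= /ph.
  have eM' : e * M%:R <= (z M).2%:R by near: M.
  rewrite (_ : _ * _ = (pi / (N M)%:R / 2) ^+ 2 * (e * M%:R)); last first.
    by move: (pi / _) => p; field.
  by rewrite ler_wpM2l// sqr_ge0.
have h : cos (ph M) ^+ (z M).2 * (cos (pi / 4))^-1 @[M --> \oo] --> (0 : R).
  rewrite -(mul0r (cos (pi / 4))^-1); apply: cvgMr_tmp.
  exact: (cvg_cosX0 ph_gt0 ph0 phy).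
apply: squeeze_cvgr (cvg_cst 0) h; near=> M.
rewrite surv_ge0 /=.
have N0 : 0 < (N M)%:R :> R by near: M; exact: near_NR_gt0.
have N1 : (1 < N M)%N by near: M; exact: near_N_ge.
have -> : pi / 4 = ph M * (N M)%:R / 2 by rewrite /ph; field; rewrite gt_eqF.
apply: surv_le_cosX => //.
- by apply/ltW; near: M.
- rewrite (_ : _ * _ = pi / 2); last by rewrite /ph; field; rewrite gt_eqF.
  by have := @pi_gt0 R; lra.
- by rewrite -ltnS.
Unshelve. all: by end_near. Qed.

Lemma cvg_aM_truncn (t : R) : 0 <= t ->
  a M * (Num.truncn (t / a M))%:R @[M --> \oo] --> t.
Proof.
move=> t0.
have h : t - a M @[M --> \oo] --> t.
  rewrite -[X in _ --> X]subr0; apply: cvgB; first exact: cvg_cst.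
  exact: cvg_a.
apply: squeeze_cvgr h (cvg_cst t); near=> M.
have a0 : 0 < a M by near: M; exact: near_a_gt0.
move: (a M) a0 => b b0.
have /truncn_itv/andP[] : 0 <= t / b by rewrite divr_ge0// ltW.
rewrite ler_pdivlMr// ltr_pdivrMr// -natr1.
by move: (_%:R) => m h1 h2; apply/andP; split; lra.
Unshelve. all: by end_near. Qed.

Section Bounds.
Variable ka : R.
Hypothesis ka_gt0 : 0 < ka.
Local Notation th := (fun M => Num.sqrt (2 * ka * a M)).
Local Notation be := (fun M => th M * (N M)%:R / 2).

Lemma near_avoid_gt (t e : R) : 1 < ka -> 0 <= t -> e < expR (- (ka * t)) ->
  \forall M \near \oo, e < alive M (Num.truncn (t / a M)) (z M).
Proof.
move=> ka1 t0 et.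
have cb : (cos (be M))^-1 @[M --> \oo] --> (1 : R).
  by rewrite -[X in _ --> X]invr1; apply: cvgV => //; exact: cvg_cos_be.
have ct (k : nat -> nat) : a M * (k M)%:R @[M --> \oo] --> 0 ->
    (cos (th M))^-1 ^+ k M @[M --> \oo] --> (1 : R).
  move=> ak0; rewrite -[X in _ --> X]invr1.
  rewrite (_ : (fun M => _) = fun M => (cos (th M) ^+ k M)^-1); last first.
    by apply/funext => M; rewrite exprVn.
  apply: cvgV => //.
  by have := cvg_cos_thX N_cvg MN_cvg ka_gt0 ak0; rewrite mulr0 oppr0 expR0.
have L : cos (be M) * cos (th M) ^+ Num.truncn (t / a M) *
    (1 - (cos (be M))^-1 * (cos (th M))^-1 ^+ M * surv R (N M) (z M).2 (z M).1)
    @[M --> \oo] --> 1 * expR (- (ka * t)) * (1 - 1 * 1 * 0).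
  apply: cvgM.
    apply: cvgM; first exact: cvg_cos_be.
    by apply: cvg_cos_thX => //; exact: cvg_aM_truncn.
  apply: cvgB; first exact: cvg_cst.
  apply: cvgM; last exact: cvg_surv_start.
  by apply: cvgM => //; apply: (ct id); exact: cvg_aM.
(* The hypothesis of [avoid_ge_cosX], divided by a N, has a gap tending to 1 - ka < 0. *)
have C : (cos (be M))^-1 * (cos (th M))^-1 ^+ M.+1 *
    (surv R (N M) M 1 / (a M * (N M)%:R))
    - tan (th M) * tan (be M) / (a M * (N M)%:R) @[M --> \oo] --> 1 * 1 * 1 - ka.
  apply: cvgB; last exact: cvg_tan_tan.
  apply: cvgM; last exact: cvg_surv1.
  apply: cvgM => //; apply: (ct (fun M => M.+1)).
  rewrite (_ : (fun M => _) = fun M => a M * M%:R + a M); last first.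
    by apply/funext => M; rewrite -(natr1 M) mulrDr mulr1.
  rewrite -[X in _ --> X]addr0; apply: cvgD; [exact: cvg_aM|exact: cvg_a].
near=> M.
have N0 : 0 < (N M)%:R :> R by near: M; exact: near_NR_gt0.
have a0 : 0 < a M by near: M; exact: near_a_gt0.
have N1 : (1 < N M)%N by near: M; exact: near_N_ge.
have thN : th M * (N M)%:R < pi by near: M; exact: near_thN.
have aN0 : 0 < (a M * (N M)%:R)^-1 by rewrite invr_gt0 mulr_gt0.
apply: lt_le_trans _ (avoid_ge_cosX N1 (sqrtr_ge0 _) thN _ _ _).
  near: M; apply: (cvgr_gt _ L).
  by rewrite !mul1r subr0 mulr1.
rewrite -subr_le0 -(pmulr_lle0 _ aN0) mulrBl -[X in X - _]mulrA; apply/ltW.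
near: M; apply: (cvgr_lt _ C).
by rewrite !mul1r subr_lt0.
Unshelve. all: by end_near. Qed.

Lemma near_avoid_lt (t e : R) : ka < 1 -> 0 < t -> expR (- (ka * t)) < e ->
  \forall M \near \oo, alive M (Num.truncn (t / a M)) (z M) < e.
Proof.
move=> ka1 t0 et.
have cb : (cos (be M))^-1 @[M --> \oo] --> (1 : R).
  by rewrite -[X in _ --> X]invr1; apply: cvgV => //; exact: cvg_cos_be.
have d0 : a M * (Num.truncn (t / a M))%:R - a M * M%:R @[M --> \oo] --> t.
  rewrite -[X in _ --> X]subr0.
  by apply: cvgB; [exact: (cvg_aM_truncn (ltW t0))|exact: cvg_aM].
(* The upper bound starts at time M, so the target time must exceed M; this holds eventually because
   a M tends to 0 and t > 0. *)
have mM : \forall M \near \oo, (M <= Num.truncn (t / a M))%N.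
  near=> M; have a0 : 0 < a M by near: M; exact: near_a_gt0.
  rewrite -(ler_nat R) -(ler_pM2l a0) -subr_ge0; apply/ltW; near: M.
  exact: (cvgr_gt _ d0).
have U : cos (th M) ^+ (Num.truncn (t / a M) - M) * (cos (be M))^-1
    @[M --> \oo] --> expR (- (ka * t)) * 1.
  apply: cvgM => //; apply: cvg_cos_thX => //; apply: cvg_near_eq d0; near=> M.
  by rewrite natrB ?mulrBr//; near: M.
have C : tan (th M) * tan (be M) / (a M * (N M)%:R) -
    surv R (N M) M 1 / (a M * (N M)%:R) @[M --> \oo] --> ka - 1.
  by apply: cvgB; [exact: cvg_tan_tan|exact: cvg_surv1].
near=> M.
have N0 : 0 < (N M)%:R :> R by near: M; exact: near_NR_gt0.
have a0 : 0 < a M by near: M; exact: near_a_gt0.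
have N1 : (1 < N M)%N by near: M; exact: near_N_ge.
have thN : th M * (N M)%:R < pi by near: M; exact: near_thN.
have aN0 : 0 < (a M * (N M)%:R)^-1 by rewrite invr_gt0 mulr_gt0.
have mM' : (M <= Num.truncn (t / a M))%N by near: M.
rewrite -[X in avoid _ _ X](subnK mM').
apply: le_lt_trans (avoid_le_cosX N1 (sqrtr_ge0 _) thN _ _ _) _.
  rewrite -subr_le0 -(pmulr_lle0 _ aN0) mulrBl; apply/ltW.
  near: M; apply: (cvgr_lt _ C).
  by rewrite subr_lt0.
near: M; apply: (cvgr_lt _ U).
by rewrite mulr1.
Unshelve. all: by end_near. Qed.

End Bounds.

End Limit.

(** By continuity of exp(- ka t) at ka = 1, rates slightly above and below 1 bring the lower and
    upper bounds within e of exp(- t). *)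
Lemma cvg_avoid (R : realType) (N : nat -> nat) (z : forall M, fc_state (N M) M)
    (t : R) :
  N M @[M --> \oo] --> \oo ->
  (M%:R / (N M)%:R ^+ 2 : R) @[M --> \oo] --> +oo ->
  (0 < limn_einf (fun M => ((z M).2%:R / M%:R : R)%:E))%E -> 0 <= t ->
  avoid (@fc_trans R (N M) M) (@fc_absorbed (N M) M)
    (Num.truncn (t / (4 / (N M)%:R ^+ 2 * cos (pi / (N M)%:R) ^+ M))) (z M)
    @[M --> \oo] --> expR (- t).
Proof.
move=> N_cvg MN_cvg y_liminf t0; apply/cvgrPdist_lt => e e0.
have ex : expR (- (ka * t)) @[ka --> (1 : R)] --> expR (- t).
  rewrite -[X in expR (- X)]mul1r.
  apply: continuous_cvg; first exact: continuous_expR.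
  by apply: cvgN; apply: cvgMr_tmp; exact: cvg_id.
have [k [k1 ke]] : exists k : R, 1 < k /\ expR (- t) - e < expR (- (k * t)).
  near (1 : R)^'+ => k; exists k; split; first by near: k; exact: nbhs_right_gt.
  near: k; apply: (cvgr_gt _ (cvg_at_right_filter ex)).
  by rewrite ltrBlDr ltrDl.
have k0 : 0 < k by exact: lt_trans k1.
have low := near_avoid_gt N_cvg MN_cvg y_liminf k0 k1 t0 ke.
have [j [j0 j1 je]] : exists j : R, [/\ 0 < j, j < 1 &
    expR (- (j * t)) < expR (- t) + e].
  near (1 : R)^'- => j; exists j; split; near: j.
  - exact: nbhs_left_gt.
  - exact: nbhs_left_lt.
  - by apply: (cvgr_lt _ (cvg_at_left_filter ex)); rewrite ltrDl.
have up : \forall M \near \oo, avoid (@fc_trans R (N M) M) (@fc_absorbed (N M) M)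
    (Num.truncn (t / (4 / (N M)%:R ^+ 2 * cos (pi / (N M)%:R) ^+ M))) (z M)
    < expR (- t) + e.
  (* [near_avoid_lt] requires t > 0; at t = 0 the survival probability at time 0 is at most 1. *)
  move: t0; rewrite le_eqVlt => /predU1P[<-|t0]; last first.
    exact: (near_avoid_lt z N_cvg MN_cvg j0 j1 t0 je).
  near=> M; rewrite mul0r truncn0 oppr0 expR0 /=; case: ifP => _; lra.
near=> M; rewrite distrC ltr_norml; apply/andP; split.
  by rewrite ltrBrDr addrC; near: M.
by rewrite ltrBlDr addrC; near: M.
Unshelve. all: by end_near. Qed.

Theorem theorem2p5 (R : realType) (N : nat -> nat)
    (z : forall M, fc_state (N M) M)
    (d : nat -> measure_display) (T : forall M, measurableType (d M))
    (P : forall M, probability (T M) R)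
    (zeta : forall M, nat -> T M -> fc_state (N M) M)
    (N_ge2 : forall M, (0 < M)%N -> (2 <= N M)%N)
    (N_cvg : N M @[M --> \oo] --> \oo)
    (MN_cvg : (M%:R / (N M)%:R ^+ 2 : R) @[M --> \oo] --> +oo)
    (y_liminf : (0 < limn_einf (fun M => ((z M).2%:R / M%:R : R)%:E))%E)
    (zeta_model : forall M, (0 < M)%N -> fc_model (z M) (P M) (zeta M)) :
  cvg_in_distribution P
    (fun M w =>
       ((4 / (N M)%:R ^+ 2 * cos (pi / (N M)%:R) ^+ M)%:E
        * lifetime R (zeta M) w)%E)
    (exponential_prob 1).
Proof.
move=> t _; have [t0|t0] := ltP t 0.
  rewrite exponential_prob_lt0//; apply: cvg_near_cst; near=> M.
  have a0 : 0 < 4 / (N M)%:R ^+ 2 * cos (pi / (N M)%:R) ^+ M :> R.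
    by near: M; exact: near_a_gt0.
  by rewrite lifetime_lt0E// measure0.
rewrite exponential_prob_ge0// mulN1r.
pose p M : R := avoid (@fc_trans R (N M) M) (@fc_absorbed (N M) M)
  (Num.truncn (t / (4 / (N M)%:R ^+ 2 * cos (pi / (N M)%:R) ^+ M))) (z M).
have PE : \forall M \near \oo, P M [set w | ((4 / (N M)%:R ^+ 2 *
    cos (pi / (N M)%:R) ^+ M)%:E * lifetime R (zeta M) w <= t%:E)%E] = (1 - p M)%:E.
  near=> M.
  have a0 : 0 < 4 / (N M)%:R ^+ 2 * cos (pi / (N M)%:R) ^+ M :> R.
    by near: M; exact: near_a_gt0.
  have M0 : (0 < M)%N by near: M; exact: nbhs_infty_gt.
  rewrite lifetime_leE//; set m := Num.truncn _.
  have [mB PB] := markov_chain_avoid (@fc_absorbed (N M) M) m (zeta_model M M0).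
  by rewrite probability_setC// PB EFinB.
(* Convergence in the extended reals reduces to eventual finiteness and convergence of the real
   values [1 - p M]. *)
apply/fine_cvgP; split; first by apply: filterS PE => M ->.
have h : 1 - p M @[M --> \oo] --> 1 - expR (- t).
  by apply: cvgB; [exact: cvg_cst|exact: cvg_avoid].
by apply: cvg_near_eq h; apply: filterS PE => M /= ->.
Unshelve. all: by end_near. Qed.
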